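(* Let $f,g$ be two slice regular functions on $\mathbb{B}$ such that $f$ has no zeros in $\mathbb{B}$. Then $$\mathrm{Re}\big(f(q)^{-1}g(q)\big)>0\ \text{ for all } q\in\mathbb{B}\quad\Longleftrightarrow\quad\mathrm{Re}\big(f(q)^{-\ast}\ast g(q)\big)>0\ \text{ for all } q\in\mathbb{B},$$ and $$|g(q)|<|f(q)|\ \text{ for all } q\in\mathbb{B}\quad\Longleftrightarrow\quad|f(q)^{-\ast}\ast g(q)|<1\ \text{ for all } q\in\mathbb{B}.$$
   Context: $\mathbb{H}$ denotes the quaternions, $\mathbb{B}=\{q\in\mathbb{H}:|q|<1\}$, $\mathbb{S}=\{q\in\mathbb{H}:q^2=-1\}$; for $I\in\mathbb{S}$, $\mathbb{C}_I=\mathbb{R}\oplus I\mathbb{R}$ and $\mathbb{B}_I=\mathbb{B}\cap\mathbb{C}_I$. A function $f:\mathbb{B}\to\mathbb{H}$ is (left) slice regular if for every $I\in\mathbb{S}$ the restriction $f_I=f|_{\mathbb{B}_I}$ has continuous partial derivatives and $\frac12\left(\frac{\partial}{\partial x}+I\frac{\partial}{\partial y}\right)f_I(x+yI)=0$ on $\mathbb{B}_I$; equivalently $f(q)=\sum_{n\ge0}q^na_n$ on $\mathbb{B}$ with $a_n\in\mathbb{H}$. For slice regular $f=\sum q^na_n$, $g=\sum q^nb_n$ on $\mathbb{B}$: the regular product is $f\ast g(q)=\sum_n q^n\sum_{k=0}^n a_kb_{n-k}$; the regular conjugate is $f^c(q)=\sum q^n\overline{a_n}$; the symmetrization is $f^s=f\ast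 f^c$; the regular reciprocal is $f^{-\ast}(q)=f^s(q)^{-1}f^c(q)$ off the zero set of $f^s$, and $f^{-\ast}\ast g(q)=f^s(q)^{-1}(f^c\ast g)(q)$ there. (If $f$ has no zeros in $\mathbb{B}$ then neither has $f^s$.) The notation $f(q)^{-\ast}\ast g(q)$ means $(f^{-\ast}\ast g)(q)$, while $f(q)^{-1}g(q)$ is the pointwise quaternionic product. *)

(* Defs.v *)
From Stdlib Require Import Reals ClassicalEpsilon.
From Coquelicot Require Import Coquelicot.
Open Scope R_scope.

(** * Quaternions *)

(* [(a, b, c, d)] is a + b i + c j + d k.  As an iterated product of copies of
   [R], [quat] inherits Coquelicot's real normed module structure, whose norm
   is the Euclidean one up to equivalence; it is used below only for sums,
   real scalings, limits, derivatives and series. *)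
Definition quat : Type := (R * R * R * R)%type.

Definition qreal (a : R) : quat := (a, 0, 0, 0).

Definition qre (p : quat) : R := let '(a, _, _, _) := p in a.

Definition qconj (p : quat) : quat :=
  let '(a, b, c, d) := p in (a, - b, - c, - d).

Definition qmul (p q : quat) : quat :=
  let '(a1, b1, c1, d1) := p in
  let '(a2, b2, c2, d2) := q in
  (a1 * a2 - b1 * b2 - c1 * c2 - d1 * d2,
   a1 * b2 + b1 * a2 + c1 * d2 - d1 * c2,
   a1 * c2 - b1 * d2 + c1 * a2 + d1 * b2,
   a1 * d2 + b1 * c2 - c1 * b2 + d1 * a2).

Definition qabs (p : quat) : R :=
  let '(a, b, c, d) := p in sqrt (a ^ 2 + b ^ 2 + c ^ 2 + d ^ 2).

Definition qinv (p : quat) : quat := scal (/ (qabs p ^ 2)) (qconj p).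

Fixpoint qpow (q : quat) (n : nat) : quat :=
  match n with
  | O => qreal 1
  | S m => qmul q (qpow q m)
  end.

Definition in_ball (q : quat) : Prop := qabs q < 1.

Definition imag_unit (I : quat) : Prop := qmul I I = qreal (- 1).

Definition slice_pt (I : quat) (x y : R) : quat :=
  plus (qreal x) (qmul (qreal y) I).

(** * Slice regular functions *)

(* A function on the ball is represented by a total function on [quat]; only
   its values on the ball matter.  [Dx] and [Dy] are the partial derivatives
   of the restriction of [f] to the slice B_I, in the coordinates x + y I. *)
Definition slice_regular (f : quat -> quat) : Prop :=
  forall I : quat, imag_unit I ->
  exists Dx Dy : R * R -> quat,
  forall x y : R, in_ball (slice_pt I x y) ->
    is_derive (fun t : R => f (slice_pt I t y)) x (Dx (x, y)) /\
    is_derive (fun t : R => f (slice_pt I x t)) y (Dy (x, y)) /\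
    continuous Dx (x, y) /\
    continuous Dy (x, y) /\
    scal (1 / 2) (plus (Dx (x, y)) (qmul I (Dy (x, y)))) = qreal 0.

(* f(q) = sum_n q^n a_n on the ball. *)
Definition is_expansion (f : quat -> quat) (a : nat -> quat) : Prop :=
  forall q : quat, in_ball q ->
    is_series (fun n : nat => qmul (qpow q n) (a n)) (f q).

(* Every slice regular function has exactly one expansion, so that [coeffs f]
   is then its sequence of coefficients; otherwise it is unspecified. *)
Definition coeffs (f : quat -> quat) : nat -> quat :=
  epsilon (inhabits (fun _ : nat => qreal 0)) (is_expansion f).

(* Sum of a series of quaternions, computed componentwise; meaningful only for
   convergent series. *)
Definition qSeries (u : nat -> quat) : quat :=
  (Series (fun n => let '(a, _, _, _) := u n in a),
   Series (fun n => let '(_, b, _, _) := u n in b),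
   Series (fun n => let '(_, _, c, _) := u n in c),
   Series (fun n => let '(_, _, _, d) := u n in d)).

Definition qPSeries (a : nat -> quat) (q : quat) : quat :=
  qSeries (fun n => qmul (qpow q n) (a n)).

(** * Regular operations *)

(* [sum_n u n] is u_0 + ... + u_n. *)
Definition reg_mul (f g : quat -> quat) : quat -> quat :=
  qPSeries (fun n => sum_n (fun k => qmul (coeffs f k) (coeffs g (n - k))) n).

Definition reg_conj (f : quat -> quat) : quat -> quat :=
  qPSeries (fun n => qconj (coeffs f n)).

Definition reg_symm (f : quat -> quat) : quat -> quat :=
  reg_mul f (reg_conj f).

(* f^{-*} * g = (f^s)^{-1} (f^c * g), off the zero set of f^s. *)
Definition reg_recip_mul (f g : quat -> quat) (q : quat) : quat :=
  qmul (qinv (reg_symm f q)) (reg_mul (reg_conj f) g q).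

(* Main.v *)
Require Import Defs.
From Stdlib Require Import Reals Lra Lia Psatz ClassicalEpsilon.
From Coquelicot Require Import Coquelicot.
Open Scope R_scope.

(* On each slice, composing f with a real linear functional gives one half of a
   pair of functions satisfying the Cauchy-Riemann equations, so Cauchy's
   integral formula yields a power series; comparing the series on the real
   axis shows that its coefficients do not depend on the slice.

   By the Cauchy product, (f * g)(q) = f(q) g(f(q)^-1 q f(q)) when f(q) <> 0.
   Since f^s = f^c * f, it follows that f^{-*} * g = (f^-1 g) o T on the ball,
   where T(q) = f^c(q)^-1 q f^c(q); here f^c has no zeros, because a zero of f^c
   on a sphere x + y S produces a zero of f on the same sphere.  Finally T maps
   the ball onto itself: T(f(p)^-1 p f(p)) = p, because f^s = f * f^c has real
   coefficients, so f^s(p) commutes with p. *)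

(** * Cauchy integral formula and power series in the unit disk *)

(** Slice regularity is a first-order condition on each slice, whereas the regular operations act on
    coefficients selected by [epsilon]. Until every slice regular function is known to have exactly
    one expansion on the whole ball, [reg_mul] and [reg_conj] cannot be computed; this is what the
    complex analysis is for, and everything after [coeffs_expansion] is about power series only.
    Noncommutativity enters through one regrouping: the product series becomes the sum of
    [q^m f(q) b_m], and moving [f(q)] to the left of [q^m] turns [q] into its conjugate by [f(q)].
    Conjugation preserves the modulus, so the new point stays in the ball. In the quotient,
    [(f^c(q) f(T q))^-1 f^c(q) g(T q)] loses the factor [f^c(q)]. As [T] maps the ball onto itself,
    the regular quotient and the pointwise quotient take the same set of values there, so any
    condition on values holds everywhere for one exactly when it does for the other; both
    equivalences are instances. *)

Definition cauchy_riemann (u v ux vx : R -> R -> R) : Prop :=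
  forall x y, x ^ 2 + y ^ 2 < 1 ->
    (is_derive (fun t => u t y) x (ux x y) /\
     is_derive (fun t => u x t) y (- vx x y)) /\
    (is_derive (fun t => v t y) x (vx x y) /\
     is_derive (fun t => v x t) y (ux x y)) /\
    (continuity_2d_pt ux x y /\ continuity_2d_pt vx x y).

(** The new pair is [-i (u + i v)], again holomorphic; results about a real part [u] thereby apply
    to [v]. *)
Lemma cauchy_riemann_rot (u v ux vx : R -> R -> R) :
  cauchy_riemann u v ux vx ->
  cauchy_riemann v (fun x y => - u x y) vx (fun x y => - ux x y).
Proof.
  intros H x y Hxy.
  destruct (H x y Hxy) as [[Hux Huy] [[Hvx Hvy] [Cux Cvx]]].
  split; [|split; [|split]]; [split|split|..].
  - exact Hvx.
  - now rewrite Ropp_involutive.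
  - now apply (is_derive_opp (fun t => u t y)).
  - rewrite <- (Ropp_involutive (vx x y)).
    now apply (is_derive_opp (fun t => u x t)).
  - exact Cvx.
  - now apply continuity_2d_pt_opp.
Qed.

Lemma continuity_2d_pt_locally_lt (f : R -> R -> R) (x y c : R) :
  continuity_2d_pt f x y -> f x y < c ->
  locally (x, y) (fun p : R * R => f (fst p) (snd p) < c).
Proof.
  intros Hf Hlt.
  apply continuity_2d_pt_filterlim in Hf.
  exact (Hf (fun t => t < c) (open_lt c _ Hlt)).
Qed.

Ltac cont2d :=
  repeat first
    [ apply continuity_2d_pt_plus | apply continuity_2d_pt_minus
    | apply continuity_2d_pt_mult | apply continuity_2d_pt_opp
    | apply continuity_2d_pt_const | apply continuity_2d_pt_id1
    | apply continuity_2d_pt_id2 ].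

Lemma locally_unit_disk (x y : R) :
  x ^ 2 + y ^ 2 < 1 ->
  locally (x, y) (fun p : R * R => fst p ^ 2 + snd p ^ 2 < 1).
Proof.
  intros Hxy.
  apply (continuity_2d_pt_locally_lt (fun a b => a ^ 2 + b ^ 2)); auto.
  simpl; cont2d.
Qed.

Lemma cauchy_riemann_differentiable (u v ux vx : R -> R -> R) (x y : R) :
  cauchy_riemann u v ux vx -> x ^ 2 + y ^ 2 < 1 ->
  differentiable_pt_lim u x y (ux x y) (- vx x y).
Proof.
  intros H Hxy.
  apply filterdiff_differentiable_pt_lim.
  apply (is_derive_filterdiff u x y ux (- vx x y)).
  - generalize (locally_unit_disk x y Hxy); apply filter_imp.
    intros [a b] Hab; simpl in *.
    now destruct (H a b Hab) as [[Hd _] _].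
  - now destruct (H x y Hxy) as [[_ Hd] _].
  - apply continuity_2d_pt_filterlim.
    now destruct (H x y Hxy) as [_ [_ [Hc _]]].
Qed.

Lemma cauchy_riemann_continuity_2d (u v ux vx : R -> R -> R) (x y : R) :
  cauchy_riemann u v ux vx -> x ^ 2 + y ^ 2 < 1 -> continuity_2d_pt u x y.
Proof.
  intros H Hxy.
  apply differentiable_continuity_pt.
  exists (ux x y), (- vx x y).
  now apply (cauchy_riemann_differentiable u v).
Qed.

(** The chain rule [Re (F' Z')] with [F' = ux + i vx] and [Z' = dX + i dY]. *)
Lemma cauchy_riemann_path (u v ux vx : R -> R -> R) (X Y : R -> R) (t dX dY : R) :
  cauchy_riemann u v ux vx -> X t ^ 2 + Y t ^ 2 < 1 ->
  is_derive X t dX -> is_derive Y t dY ->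
  is_derive (fun s => u (X s) (Y s)) t
    (ux (X t) (Y t) * dX - vx (X t) (Y t) * dY).
Proof.
  intros H Ht HX HY.
  apply is_derive_Reals.
  replace (_ - _) with (ux (X t) (Y t) * dX + (- vx (X t) (Y t)) * dY) by ring.
  apply (derivable_pt_lim_comp_2d u X Y).
  - now apply (cauchy_riemann_differentiable u v).
  - now apply is_derive_Reals.
  - now apply is_derive_Reals.
Qed.

(** This is the triangle inequality for [(1 - l) z + l w], squared; [l] may lie outside [[0, 1]]. *)
Lemma segment_disk (a b c d R l : R) :
  0 <= R -> a ^ 2 + b ^ 2 <= R ^ 2 -> c ^ 2 + d ^ 2 <= R ^ 2 ->
  ((1 - l) * a + l * c) ^ 2 + ((1 - l) * b + l * d) ^ 2
    <= ((Rabs (1 - l) + Rabs l) * R) ^ 2.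
Proof.
  intros HR Hab Hcd.
  assert (Hcs : Rabs (a * c + b * d) <= R ^ 2).
  { assert (H1 := pow2_ge_0 (a + c)); assert (H2 := pow2_ge_0 (b + d)).
    assert (H3 := pow2_ge_0 (a - c)); assert (H4 := pow2_ge_0 (b - d)).
    apply Rabs_le; split; nra. }
  assert (H : (1 - l) * l * (a * c + b * d) <= Rabs (1 - l) * Rabs l * R ^ 2).
  { eapply Rle_trans; [apply Rle_abs|].
    rewrite !Rabs_mult.
    apply Rmult_le_compat_l; auto.
    apply Rmult_le_pos; apply Rabs_pos. }
  assert (H1 := Rsqr_abs (1 - l)); assert (H2 := Rsqr_abs l); unfold Rsqr in *.
  nra.
Qed.

Lemma continuity_2d_pt_comp2 (u X Y : R -> R -> R) (x y : R) :
  continuity_2d_pt u (X x y) (Y x y) ->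
  continuity_2d_pt X x y -> continuity_2d_pt Y x y ->
  continuity_2d_pt (fun a b => u (X a b) (Y a b)) x y.
Proof.
  intros Hu HX HY.
  apply continuity_2d_pt_filterlim in Hu, HX, HY.
  apply continuity_2d_pt_filterlim.
  apply (continuous_comp_2 (fun p : R * R => X (fst p) (snd p))
    (fun p : R * R => Y (fst p) (snd p)) u (x, y)); auto.
Qed.

Lemma continuity_2d_pt_snd (h : R -> R) (x y : R) :
  continuous h y -> continuity_2d_pt (fun _ b => h b) x y.
Proof.
  intros Hh.
  apply (continuity_1d_2d_pt_comp h (fun _ b => b)).
  - now apply continuity_pt_filterlim.
  - apply continuity_2d_pt_id2.
Qed.

Lemma continuity_2d_pt_section (f : R -> R -> R) (x y : R) :
  continuity_2d_pt f x y -> continuous (f x) y.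
Proof.
  intros Hf.
  apply continuity_2d_pt_filterlim in Hf.
  apply (continuous_comp_2 (fun _ => x) (fun t => t) f y); auto.
  - apply continuous_const.
  - apply continuous_id.
Qed.

(* K1 + i K2 is the kernel w / (w - z) with w = r e^(it).  With u + iv = F, the
   integral of Re (F (z + l (w - z)) (K1 + i K2)) does not depend on l in [0, 1]:
   its l-derivative has integrand (1 / l) d/dt v (z + l (w - z)). *)
Lemma cauchy_homotopy (u v ux vx : R -> R -> R) (x0 y0 r : R) (K1 K2 : R -> R) :
  cauchy_riemann u v ux vx -> 0 <= r < 1 -> x0 ^ 2 + y0 ^ 2 <= r ^ 2 ->
  (forall t, continuous K1 t) -> (forall t, continuous K2 t) ->
  (forall t, (r * cos t - x0) * K1 t - (r * sin t - y0) * K2 t = r * cos t) ->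
  (forall t, (r * cos t - x0) * K2 t + (r * sin t - y0) * K1 t = r * sin t) ->
  RInt (fun t => u (r * cos t) (r * sin t) * K1 t
                 - v (r * cos t) (r * sin t) * K2 t) 0 (2 * PI)
  = RInt (fun t => u x0 y0 * K1 t - v x0 y0 * K2 t) 0 (2 * PI).
Proof.
  intros H Hr Hz CK1 CK2 HK1 HK2.
  set (X := fun l t => (1 - l) * x0 + l * (r * cos t)).
  set (Y := fun l t => (1 - l) * y0 + l * (r * sin t)).
  set (G := fun l t => u (X l t) (Y l t) * K1 t - v (X l t) (Y l t) * K2 t).
  set (dG := fun l t => ux (X l t) (Y l t) * (r * cos t)
                        - vx (X l t) (Y l t) * (r * sin t)).
  (* An open set of parameters that contains [[0, 1]] because [r < 1]; it leaves room for two-sided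
     derivatives at 0 and 1. *)
  set (D := fun l => (Rabs (1 - l) + Rabs l) * r < 1).
  assert (Hcirc : forall t, (r * cos t) ^ 2 + (r * sin t) ^ 2 <= r ^ 2).
  { intros t; assert (Hcs := sin2_cos2 t); unfold Rsqr in Hcs; nra. }
  assert (HD : forall l t, D l -> X l t ^ 2 + Y l t ^ 2 < 1).
  { intros l t Hl; unfold X, Y, D in *.
    eapply Rle_lt_trans; [now apply (segment_disk _ _ _ _ r)|].
    assert (0 <= (Rabs (1 - l) + Rabs l) * r).
    { assert (H1 := Rabs_pos (1 - l)); assert (H2 := Rabs_pos l); nra. }
    nra. }
  assert (HDo : forall l, D l -> locally l D).
  { intros l Hl; unfold D in *.
    assert (Hc : continuous (fun a => (Rabs (1 - a) + Rabs a) * r) l).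
    { apply (continuous_mult (K := R_AbsRing)); [|apply continuous_const].
      apply (continuous_plus (V := R_NormedModule)).
      - apply (continuous_comp (fun a => 1 - a) Rabs).
        + apply (continuous_minus (V := R_NormedModule));
            [apply continuous_const | apply continuous_id].
        + apply continuous_Rabs.
      - apply continuous_Rabs. }
    exact (Hc (fun t => t < 1) (open_lt 1 _ Hl)). }
  assert (HD01 : forall l, 0 <= l <= 1 -> D l).
  { intros l Hl; unfold D; rewrite !Rabs_pos_eq; lra. }
  assert (CX : forall l t, continuity_2d_pt X l t).
  { intros l t; unfold X; cont2d.
    apply (continuity_2d_pt_snd cos), continuous_cos. }
  assert (CY : forall l t, continuity_2d_pt Y l t).
  { intros l t; unfold Y; cont2d.
    apply (continuity_2d_pt_snd sin), continuous_sin. }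
  assert (HdG : forall l t, D l -> is_derive (fun s => G s t) l (dG l t)).
  { intros l t Hl; unfold G, dG.
    assert (HdX : is_derive (fun s => X s t) l (r * cos t - x0)).
    { unfold X; auto_derive; [auto|ring]. }
    assert (HdY : is_derive (fun s => Y s t) l (r * sin t - y0)).
    { unfold Y; auto_derive; [auto|ring]. }
    assert (Hu := cauchy_riemann_path u v ux vx _ _ l _ _ H (HD l t Hl) HdX HdY).
    assert (Hv := cauchy_riemann_path _ _ _ _ _ _ l _ _
      (cauchy_riemann_rot _ _ _ _ H) (HD l t Hl) HdX HdY).
    apply (is_derive_scal _ _ (K1 t)) in Hu.
    apply (is_derive_scal _ _ (K2 t)) in Hv.
    assert (Huv := is_derive_minus _ _ _ _ _ Hu Hv).
    unfold minus, plus, opp, scal in Huv; simpl in Huv.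
    unfold mult in Huv; simpl in Huv.
    (* By [HK1] and [HK2], [(w - z) K = w], so the derivative [Re (F' (w - z) K)] loses the kernel
       and becomes [Re (F' w)]. *)
    replace (ux (X l t) (Y l t) * (r * cos t) - vx (X l t) (Y l t) * (r * sin t))
      with (K1 t * (ux (X l t) (Y l t) * (r * cos t - x0)
                    - vx (X l t) (Y l t) * (r * sin t - y0))
            + - (K2 t * (vx (X l t) (Y l t) * (r * cos t - x0)
                         - - ux (X l t) (Y l t) * (r * sin t - y0)))).
    2:{ transitivity
          (ux (X l t) (Y l t) * ((r * cos t - x0) * K1 t - (r * sin t - y0) * K2 t)
           - vx (X l t) (Y l t) * ((r * cos t - x0) * K2 t + (r * sin t - y0) * K1 t)).
        - ring.
        - now rewrite HK1, HK2. }
    revert Huv; apply is_derive_ext; intros s; simpl; ring. }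
  assert (CG : forall l t, D l -> continuity_2d_pt G l t).
  { intros l t Hl; unfold G; cont2d.
    - apply continuity_2d_pt_comp2; auto.
      now apply (cauchy_riemann_continuity_2d u v ux vx), HD.
    - now apply continuity_2d_pt_snd.
    - apply continuity_2d_pt_comp2; auto.
      now apply (cauchy_riemann_continuity_2d _ _ _ _ _ _ (cauchy_riemann_rot _ _ _ _ H)), HD.
    - now apply continuity_2d_pt_snd. }
  assert (CdG : forall l t, D l -> continuity_2d_pt dG l t).
  { intros l t Hl; unfold dG.
    destruct (H _ _ (HD l t Hl)) as [_ [_ [Cux Cvx]]].
    cont2d.
    - now apply continuity_2d_pt_comp2.
    - apply (continuity_2d_pt_snd cos), continuous_cos.
    - now apply continuity_2d_pt_comp2.
    - apply (continuity_2d_pt_snd sin), continuous_sin. }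
  assert (HdI : forall l, D l ->
    is_derive (fun s => RInt (G s) 0 (2 * PI)) l (RInt (dG l) 0 (2 * PI))).
  { intros l Hl.
    replace (RInt (dG l) 0 (2 * PI))
      with (RInt (fun t => Derive (fun s => G s t) l) 0 (2 * PI)).
    2:{ apply RInt_ext; intros t _. now apply is_derive_unique, HdG. }
    apply (is_derive_RInt_param G).
    - generalize (HDo l Hl); apply filter_imp.
      intros s Hs t _; exists (dG s t); now apply HdG.
    - intros t _. apply continuity_2d_pt_ext_loc with dG; [|now apply CdG].
      apply locally_2d_locally.
      destruct (HDo l Hl) as [e He]; exists e; intros [a b] [Ha _]; simpl in *.
      symmetry; apply is_derive_unique, HdG, He, Ha.
    - generalize (HDo l Hl); apply filter_imp; intros s Hs.
      apply (ex_RInt_continuous (V := R_CompleteNormedModule)); intros t _.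
      now apply continuity_2d_pt_section, CG. }
  assert (HdI0 : forall l, D l -> l <> 0 -> RInt (dG l) 0 (2 * PI) = 0).
  { intros l Hl Hl0.
    (* As [t] varies, [z + l (w - z)] has velocity [i l w], and [Im (i l w F') = l Re (w F')]; the
       loop is closed, so the integral vanishes. *)
    assert (HI : is_RInt (fun t => l * dG l t) 0 (2 * PI)
      (minus (v (X l (2 * PI)) (Y l (2 * PI))) (v (X l 0) (Y l 0)))).
    { apply (is_RInt_derive (V := R_CompleteNormedModule)
        (fun t => v (X l t) (Y l t))); intros t _.
      - assert (HdX : is_derive (X l) t (- l * (r * sin t))).
        { unfold X; auto_derive; [auto|ring]. }
        assert (HdY : is_derive (Y l) t (l * (r * cos t))).
        { unfold Y; auto_derive; [auto|ring]. }
        assert (Hv := cauchy_riemann_path _ _ _ _ _ _ t _ _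
          (cauchy_riemann_rot _ _ _ _ H) (HD l t Hl) HdX HdY).
        match type of Hv with is_derive _ _ ?d =>
          replace (l * dG l t) with d by (unfold dG; ring) end.
        exact Hv.
      - apply (continuous_mult (K := R_AbsRing) (fun _ => l) (dG l)).
        + apply continuous_const.
        + now apply continuity_2d_pt_section, CdG. }
    assert (HE : minus (v (X l (2 * PI)) (Y l (2 * PI))) (v (X l 0) (Y l 0)) = 0).
    { unfold X, Y; rewrite cos_2PI, sin_2PI, cos_0, sin_0.
      exact (plus_opp_r (G := R_AbelianGroup) _). }
    rewrite HE in HI.
    apply (is_RInt_unique (V := R_CompleteNormedModule)) in HI.
    rewrite (RInt_scal (V := R_CompleteNormedModule)) in HI.
    - unfold scal in HI; simpl in HI; unfold mult in HI; simpl in HI.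
      apply Rmult_integral in HI; tauto.
    - apply (ex_RInt_continuous (V := R_CompleteNormedModule)); intros t _.
      now apply continuity_2d_pt_section, CdG. }
  (* The mean value point [c] is interior, so [c <> 0] and the division by [l] in [HdI0] is
     legitimate. *)
  destruct (MVT_cor2 (fun l => RInt (G l) 0 (2 * PI))
    (fun l => RInt (dG l) 0 (2 * PI)) 0 1 Rlt_0_1) as [c [Hc Hc01]].
  { intros c Hc; apply is_derive_Reals, HdI, HD01, Hc. }
  rewrite (HdI0 c) in Hc; [|apply HD01; lra | lra].
  transitivity (RInt (G 1) 0 (2 * PI)); [|transitivity (RInt (G 0) 0 (2 * PI))].
  - apply RInt_ext; intros t _; unfold G, X, Y.
    now replace ((1 - 1) * x0 + 1 * (r * cos t)) with (r * cos t) by ring;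
      replace ((1 - 1) * y0 + 1 * (r * sin t)) with (r * sin t) by ring.
  - lra.
  - apply RInt_ext; intros t _; unfold G, X, Y.
    now replace ((1 - 0) * x0 + 0 * (r * cos t)) with x0 by ring;
      replace ((1 - 0) * y0 + 0 * (r * sin t)) with y0 by ring.
Qed.

(** * Complex-valued integrands and the Cauchy kernel on a circle *)

Definition Ccontinuous (F : R -> C) : Prop :=
  (forall t, continuous (fun s => fst (F s)) t) /\
  (forall t, continuous (fun s => snd (F s)) t).

Lemma Ccontinuous_const (c : C) : Ccontinuous (fun _ => c).
Proof. split; intros t; apply continuous_const. Qed.

Lemma Ccontinuous_mult (F G : R -> C) :
  Ccontinuous F -> Ccontinuous G -> Ccontinuous (fun t => F t * G t)%C.
Proof.
  intros [F1 F2] [G1 G2]; split; intros t; simpl.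
  - apply (continuous_minus (V := R_NormedModule));
      now apply (continuous_mult (K := R_AbsRing)).
  - apply (continuous_plus (V := R_NormedModule));
      now apply (continuous_mult (K := R_AbsRing)).
Qed.

Lemma Ccontinuous_pow (F : R -> C) (n : nat) :
  Ccontinuous F -> Ccontinuous (fun t => F t ^ n)%C.
Proof.
  intros HF; induction n as [|n IH].
  - exact (Ccontinuous_const 1).
  - now apply (Ccontinuous_mult F (fun t => F t ^ n)%C).
Qed.

Lemma Ccontinuous_inv (F : R -> C) :
  Ccontinuous F -> (forall t, F t <> 0) -> Ccontinuous (fun t => / F t)%C.
Proof.
  intros [F1 F2] HF.
  assert (Hd : forall t, fst (F t) ^ 2 + snd (F t) ^ 2 <> 0).
  { intros t E; apply (HF t); destruct (F t) as [a b]; simpl in E.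
    replace a with 0 by nra; now replace b with 0 by nra. }
  assert (Hc : forall t, continuous (fun s => / (fst (F s) ^ 2 + snd (F s) ^ 2)) t).
  { intros t; apply continuous_Rinv_comp; auto; simpl.
    apply (continuous_plus (V := R_NormedModule));
      repeat apply (continuous_mult (K := R_AbsRing)); auto; apply continuous_const. }
  split; intros t; simpl; apply (continuous_mult (K := R_AbsRing)); auto.
  now apply (continuous_opp (V := R_NormedModule)).
Qed.

Definition circle (r t : R) : C := (r * cos t, r * sin t).

Lemma Ccontinuous_circle (r : R) : Ccontinuous (circle r).
Proof.
  split; intros t; simpl; apply (continuous_mult (K := R_AbsRing));
    auto using continuous_const, continuous_cos, continuous_sin.
Qed.

Lemma Cmod_circle (r t : R) : 0 <= r -> Cmod (circle r t) = r.
Proof.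
  intros Hr; unfold Cmod, circle; simpl.
  replace (_ + _) with (r ^ 2 * (Rsqr (sin t) + Rsqr (cos t))) by (unfold Rsqr; ring).
  now rewrite sin2_cos2, Rmult_1_r, sqrt_pow2.
Qed.

(** With [w = circle r t] one has [dw = i w dt], so [dw / (w - z)] is [i] times this kernel times
    [dt]; integrals over [t] are then normalized by [2 * PI]. *)
Definition cauchy_kernel (r : R) (z : C) (t : R) : C :=
  (circle r t / (circle r t - z))%C.

Lemma circle_neq (r t : R) (z : C) : Cmod z < r -> (circle r t - z)%C <> 0.
Proof.
  intros Hz E.
  assert (E' : circle r t = z).
  { replace (circle r t) with (circle r t - z + z)%C by ring. rewrite E; ring. }
  assert (Hr : 0 <= r) by (assert (Hm := Cmod_ge_0 z); lra).
  rewrite <- E', Cmod_circle in Hz; lra.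
Qed.

Lemma circle_neq_0 (r t : R) : 0 < r -> circle r t <> 0.
Proof.
  intros Hr; apply Cmod_gt_0; rewrite Cmod_circle; lra.
Qed.

Lemma Ccontinuous_kernel (r : R) (z : C) :
  Cmod z < r -> Ccontinuous (cauchy_kernel r z).
Proof.
  intros Hz.
  apply (Ccontinuous_mult (circle r) (fun t => / (circle r t - z))%C).
  - apply Ccontinuous_circle.
  - apply Ccontinuous_inv; [|intros t; now apply circle_neq].
    destruct (Ccontinuous_circle r) as [H1 H2]; split; intros t; simpl;
      apply (continuous_plus (V := R_NormedModule)); try apply continuous_const;
      [apply H1 | apply H2].
Qed.

Lemma ex_RInt_Re (F : R -> C) (a b : R) :
  Ccontinuous F -> ex_RInt (fun t => fst (F t)) a b.
Proof.
  intros [H _]; apply (ex_RInt_continuous (V := R_CompleteNormedModule)); auto.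
Qed.

Lemma ex_RInt_Im (F : R -> C) (a b : R) :
  Ccontinuous F -> ex_RInt (fun t => snd (F t)) a b.
Proof.
  intros [_ H]; apply (ex_RInt_continuous (V := R_CompleteNormedModule)); auto.
Qed.

Lemma RInt_Re_scal (c : C) (F : R -> C) (a b : R) :
  Ccontinuous F ->
  RInt (fun t => fst (c * F t)%C) a b
  = fst c * RInt (fun t => fst (F t)) a b - snd c * RInt (fun t => snd (F t)) a b.
Proof.
  intros HF; apply is_RInt_unique.
  apply (is_RInt_minus (V := R_NormedModule) (fun t => fst c * fst (F t)) (fun t => snd c * snd (F t)));
    apply (is_RInt_scal (V := R_NormedModule)), (RInt_correct (V := R_CompleteNormedModule)).
  - now apply ex_RInt_Re.
  - now apply ex_RInt_Im.
Qed.

Lemma RInt_Im_scal (c : C) (F : R -> C) (a b : R) :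
  Ccontinuous F ->
  RInt (fun t => snd (c * F t)%C) a b
  = fst c * RInt (fun t => snd (F t)) a b + snd c * RInt (fun t => fst (F t)) a b.
Proof.
  intros HF; apply is_RInt_unique.
  apply (is_RInt_plus (V := R_NormedModule) (fun t => fst c * snd (F t)) (fun t => snd c * fst (F t)));
    apply (is_RInt_scal (V := R_NormedModule)), (RInt_correct (V := R_CompleteNormedModule)).
  - now apply ex_RInt_Im.
  - now apply ex_RInt_Re.
Qed.

Lemma Ccontinuous_mult_circle_inv (F : R -> C) (r : R) (k : nat) :
  0 < r -> Ccontinuous F -> Ccontinuous (fun t => F t * (/ circle r t) ^ k)%C.
Proof.
  intros Hr HF; apply (Ccontinuous_mult F); auto.
  apply (Ccontinuous_pow (fun t => / circle r t)%C).
  apply Ccontinuous_inv; [apply Ccontinuous_circle|].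
  intros t; now apply circle_neq_0.
Qed.

Lemma Ccontinuous_bounded (F : R -> C) (a b : R) :
  a <= b -> Ccontinuous F ->
  exists M, 0 <= M /\ forall t, a <= t <= b -> Cmod (F t) <= M.
Proof.
  intros Hab [F1 F2].
  destruct (continuity_ab_maj (fun t => fst (F t) * fst (F t) + snd (F t) * snd (F t)) a b)
    as [s [Hs _]]; auto.
  { intros c _; apply continuity_pt_filterlim.
    change (continuous (fun t => fst (F t) * fst (F t) + snd (F t) * snd (F t)) c).
    apply (continuous_plus (V := R_NormedModule));
      apply (continuous_mult (K := R_AbsRing)); auto. }
  (* The maximum [m] is taken for the squared modulus, and [1 + m] dominates [sqrt m]. *)
  exists (1 + (fst (F s) * fst (F s) + snd (F s) * snd (F s))); split; [nra|].
  intros t Ht; specialize (Hs t Ht); unfold Cmod.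
  match goal with |- sqrt ?e <= _ => assert (He := sqrt_pos e);
    assert (He2 : sqrt e * sqrt e = e) by (apply sqrt_sqrt; nra) end.
  nra.
Qed.

(** * Geometric expansion of the Cauchy integral *)

Section KernelSeries.

Variables (F : R -> C) (r : R) (z : C).
Hypotheses (Hz : Cmod z < r) (HF : Ccontinuous F).

Let r_gt_0 : 0 < r.
Proof. assert (H := Cmod_ge_0 z); lra. Qed.

Let term (k : nat) : R :=
  fst (z ^ k)%C * RInt (fun t => fst (F t * (/ circle r t) ^ k)%C) 0 (2 * PI)
  - snd (z ^ k)%C * RInt (fun t => snd (F t * (/ circle r t) ^ k)%C) 0 (2 * PI).

(** The exact remainder after [k] terms: the kernel satisfies [K = 1 + (z / w) K], hence [K] is the
    sum of [(z / w)^j] for [j < k] plus [(z / w)^k K]. Integrating this finite identity makes the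
    partial sums telescope, so only [rem] has to be estimated. *)
Let rem (k : nat) : R :=
  RInt (fun t => fst (z ^ k * (F t * (/ circle r t) ^ k * cauchy_kernel r z t))%C)
    0 (2 * PI).

Let Ccontinuous_coef (k : nat) : Ccontinuous (fun t => F t * (/ circle r t) ^ k)%C.
Proof. now apply Ccontinuous_mult_circle_inv. Qed.

Let Ccontinuous_rem (k : nat) :
  Ccontinuous (fun t => z ^ k * (F t * (/ circle r t) ^ k * cauchy_kernel r z t))%C.
Proof.
  apply (Ccontinuous_mult (fun _ => z ^ k)%C); [apply Ccontinuous_const|].
  apply (Ccontinuous_mult (fun t => F t * (/ circle r t) ^ k)%C);
    [apply Ccontinuous_coef | now apply Ccontinuous_kernel].
Qed.

Let rem_S (k : nat) : rem k = term k + rem (S k).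
Proof.
  unfold rem, term.
  rewrite <- RInt_Re_scal by apply Ccontinuous_coef.
  rewrite <- (RInt_plus (V := R_CompleteNormedModule)).
  - apply RInt_ext; intros t _.
    assert (Hc := circle_neq_0 r t r_gt_0); assert (Hcz := circle_neq r t z Hz).
    transitivity (fst (z ^ k * (F t * (/ circle r t) ^ k)
      + z ^ (S k) * (F t * (/ circle r t) ^ (S k) * cauchy_kernel r z t))%C); [|reflexivity].
    f_equal; unfold cauchy_kernel; rewrite !Cpow_S.
    field; auto.
  - apply ex_RInt_Re, (Ccontinuous_mult (fun _ => z ^ k)%C); auto.
    apply Ccontinuous_const.
  - apply ex_RInt_Re, Ccontinuous_rem.
Qed.

(** On the circle [|z / w|] is the constant [|z| / r < 1], so a bound [M] of [|F K|] gives
    [2 * PI * M * (|z| / r)^k]. *)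
Let rem_lim : is_lim_seq rem 0.
Proof.
  destruct (Ccontinuous_bounded (fun t => F t * cauchy_kernel r z t)%C 0 (2 * PI))
    as [M [HM0 HM]].
  { assert (H := PI_RGT_0); lra. }
  { apply (Ccontinuous_mult F); auto; now apply Ccontinuous_kernel. }
  assert (Hq : 0 <= Cmod z / r < 1).
  { split.
    - apply Rdiv_le_0_compat; auto using Cmod_ge_0.
    - apply (Rmult_lt_reg_r r); auto; unfold Rdiv; rewrite Rmult_assoc, Rinv_l; lra. }
  apply is_lim_seq_abs_0.
  apply (is_lim_seq_le_le (fun _ => 0) _ (fun k => (2 * PI * M) * (Cmod z / r) ^ k)).
  - intros k; split; [apply Rabs_pos|].
    replace (2 * PI * M * (Cmod z / r) ^ k)
      with ((2 * PI - 0) * ((Cmod z / r) ^ k * M)) by ring.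
    apply abs_RInt_le_const.
    + assert (H := PI_RGT_0); lra.
    + apply ex_RInt_Re, Ccontinuous_rem.
    + intros t Ht.
      assert (Hc := circle_neq_0 r t r_gt_0).
      eapply Rle_trans; [apply Rmax_l|].
      eapply Rle_trans; [apply Rmax_Cmod|].
      replace (z ^ k * (F t * (/ circle r t) ^ k * cauchy_kernel r z t))%C
        with ((z * / circle r t) ^ k * (F t * cauchy_kernel r z t))%C
        by (rewrite Cpow_mult_l; ring).
      rewrite Cmod_mult, Cmod_pow, Cmod_mult, Cmod_inv, Cmod_circle by (auto; lra).
      apply Rmult_le_compat_l; auto. apply pow_le, Hq.
  - apply is_lim_seq_const.
  - apply is_lim_seq_ext with (fun k => scal (2 * PI * M) ((Cmod z / r) ^ k)).
    { reflexivity. }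
    replace (Finite 0) with (Rbar_mult (2 * PI * M) 0) by (simpl; f_equal; ring).
    apply is_lim_seq_scal_l, is_lim_seq_geom.
    rewrite Rabs_pos_eq; apply Hq.
Qed.

Lemma cauchy_kernel_series :
  is_series (fun k =>
    fst (z ^ k)%C * RInt (fun t => fst (F t * (/ circle r t) ^ k)%C) 0 (2 * PI)
    - snd (z ^ k)%C * RInt (fun t => snd (F t * (/ circle r t) ^ k)%C) 0 (2 * PI))
    (RInt (fun t => fst (F t * cauchy_kernel r z t)%C) 0 (2 * PI)).
Proof.
  change (is_series term (RInt (fun t => fst (F t * cauchy_kernel r z t)%C) 0 (2 * PI))).
  assert (H0 : RInt (fun t => fst (F t * cauchy_kernel r z t)%C) 0 (2 * PI) = rem 0).
  { apply RInt_ext; intros t _.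
    apply (f_equal fst); change (z ^ 0)%C with (RtoC 1);
    change ((/ circle r t) ^ 0)%C with (RtoC 1).
    match goal with |- ?a = ?b => change (@eq C a b) end; ring. }
  rewrite H0.
  assert (Hs : forall n, @eq R (sum_n term n) (rem 0 - rem (S n))).
  { induction n as [|n IH].
    - rewrite sum_O, (rem_S 0); ring.
    - rewrite sum_Sn, IH, (rem_S (S n)); unfold plus; simpl; ring. }
  change (is_lim_seq (sum_n term) (rem 0)).
  apply is_lim_seq_ext with (fun n => rem 0 - rem (S n)); [now intros n; rewrite Hs|].
  replace (Finite (rem 0)) with (Finite (rem 0 - 0)) by (f_equal; ring).
  apply is_lim_seq_minus'; [apply is_lim_seq_const|].
  now apply is_lim_seq_incr_1 in rem_lim.
Qed.

End KernelSeries.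

Lemma circle_inv_pow (r t : R) (k : nat) :
  0 < r ->
  ((/ circle r t) ^ k)%C = ((/ r) ^ k * cos (INR k * t), - ((/ r) ^ k * sin (INR k * t))).
Proof.
  intros Hr; induction k as [|k IH].
  - simpl; rewrite Rmult_0_l, cos_0, sin_0. apply injective_projections; simpl; ring.
  - rewrite Cpow_S, IH, S_INR, Rmult_plus_distr_r, Rmult_1_l, cos_plus, sin_plus.
    assert (Hi : (/ circle r t)%C = (/ r * cos t, - (/ r * sin t))).
    { assert (Hc := circle_neq_0 r t Hr).
      transitivity (/ circle r t * (circle r t * (/ r * cos t, - (/ r * sin t))%R))%C.
      - replace (circle r t * _)%C with (RtoC 1); [ring|].
        assert (Hcs := sin2_cos2 t); unfold Rsqr in Hcs.
        apply injective_projections; simpl; [|ring].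
        rewrite <- Hcs; field; lra.
      - field_simplify; auto. }
    rewrite Hi; apply injective_projections; simpl; ring.
Qed.

(** For a positive exponent the primitives of the cosine and sine terms are periodic on
    [[0, 2 * PI]]. *)
Lemma circle_coef_vanish (r : R) (k : nat) :
  0 < r ->
  RInt (fun t => fst ((/ circle r t) ^ S k)%C) 0 (2 * PI) = 0 /\
  RInt (fun t => snd ((/ circle r t) ^ S k)%C) 0 (2 * PI) = 0.
Proof.
  intros Hr.
  assert (Hk : INR (S k) <> 0) by now apply not_0_INR.
  assert (Hs : sin (INR (S k) * (2 * PI)) = 0).
  { rewrite <- sin_0, <- (sin_period 0 (S k)); f_equal; ring. }
  assert (Hc : cos (INR (S k) * (2 * PI)) = 1).
  { rewrite <- cos_0, <- (cos_period 0 (S k)); f_equal; ring. }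
  split.
  - rewrite (RInt_ext _ (fun t => (/ r) ^ S k * cos (INR (S k) * t))).
    2:{ intros t _; now rewrite circle_inv_pow. }
    apply (is_RInt_unique (V := R_CompleteNormedModule)).
    replace 0 with (minus ((/ r) ^ S k * (/ INR (S k) * sin (INR (S k) * (2 * PI))))
      ((/ r) ^ S k * (/ INR (S k) * sin (INR (S k) * 0)))) at 2.
    + apply (is_RInt_derive (V := R_CompleteNormedModule)
        (fun t => (/ r) ^ S k * (/ INR (S k) * sin (INR (S k) * t)))); intros t _.
      * generalize dependent (INR (S k)); intros x Hx _ _.
        generalize ((/ r) ^ S k); intros y. auto_derive; auto. now field.
      * apply (ex_derive_continuous (V := R_NormedModule)).
        generalize (INR (S k)); generalize ((/ r) ^ S k); intros y x. auto_derive; auto.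
    + rewrite Hs, (Rmult_0_r (INR (S k))), sin_0.
      apply (plus_opp_r (G := R_AbelianGroup)).
  - rewrite (RInt_ext _ (fun t => - ((/ r) ^ S k * sin (INR (S k) * t)))).
    2:{ intros t _; now rewrite circle_inv_pow. }
    apply (is_RInt_unique (V := R_CompleteNormedModule)).
    replace 0 with (minus ((/ r) ^ S k * (/ INR (S k) * cos (INR (S k) * (2 * PI))))
      ((/ r) ^ S k * (/ INR (S k) * cos (INR (S k) * 0)))) at 2.
    + apply (is_RInt_derive (V := R_CompleteNormedModule)
        (fun t => (/ r) ^ S k * (/ INR (S k) * cos (INR (S k) * t)))); intros t _.
      * generalize dependent (INR (S k)); intros x Hx _ _.
        generalize ((/ r) ^ S k); intros y. auto_derive; auto. now field.
      * apply (ex_derive_continuous (V := R_NormedModule)).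
        generalize (INR (S k)); generalize ((/ r) ^ S k); intros y x. auto_derive; auto.
    + rewrite Hc, (Rmult_0_r (INR (S k))), cos_0.
      apply (plus_opp_r (G := R_AbelianGroup)).
Qed.

Lemma is_series_single (a : nat -> R) :
  (forall k, a (S k) = 0) -> is_series a (a 0%nat).
Proof.
  intros Ha.
  assert (Hs : forall n, sum_n a n = a 0%nat).
  { induction n as [|n IH]; [apply sum_O|].
    rewrite sum_Sn, IH, Ha; apply (plus_zero_r (G := R_AbelianGroup)). }
  change (is_lim_seq (sum_n a) (a 0%nat)).
  apply is_lim_seq_ext with (fun _ => a 0%nat); [now intros n; rewrite Hs|].
  apply is_lim_seq_const.
Qed.

(** The kernel has mean value 1: in its expansion for constant [F], every term after the first
    vanishes. This evaluates the integral at which [cauchy_homotopy] ends. *)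
Lemma RInt_const_kernel (r : R) (z c : C) :
  Cmod z < r ->
  RInt (fun t => fst (c * cauchy_kernel r z t)%C) 0 (2 * PI) = 2 * PI * fst c.
Proof.
  intros Hz.
  assert (Hr : 0 < r) by (assert (H := Cmod_ge_0 z); lra).
  assert (Hs := cauchy_kernel_series (fun _ => c) r z Hz (Ccontinuous_const c)).
  set (term := fun k : nat => _ - _) in Hs.
  assert (Hpow : forall k, Ccontinuous (fun t => (/ circle r t) ^ k)%C).
  { intros k; apply (Ccontinuous_pow (fun t => / circle r t)%C).
    apply Ccontinuous_inv; [apply Ccontinuous_circle|].
    intros t; now apply circle_neq_0. }
  assert (Hterm : forall k, term (S k) = 0).
  { intros k; unfold term.
    destruct (circle_coef_vanish r k Hr) as [E1 E2].
    rewrite RInt_Re_scal, RInt_Im_scal, E1, E2 by auto.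
    ring. }
  rewrite <- (is_series_unique _ _ Hs), (is_series_unique _ _ (is_series_single term Hterm)).
  unfold term; simpl.
  rewrite (RInt_ext _ (fun _ => fst c)) by (intros t _; simpl; ring).
  rewrite (RInt_const (V := R_CompleteNormedModule)).
  unfold scal; simpl; unfold mult; simpl. ring.
Qed.

Lemma cauchy_riemann_circle (u v ux vx : R -> R -> R) (r : R) :
  cauchy_riemann u v ux vx -> 0 <= r < 1 ->
  Ccontinuous (fun t => (u (r * cos t) (r * sin t), v (r * cos t) (r * sin t))).
Proof.
  intros H Hr.
  assert (Hc : forall t, (r * cos t) ^ 2 + (r * sin t) ^ 2 < 1).
  { intros t; assert (Hcs := sin2_cos2 t); unfold Rsqr in Hcs; nra. }
  assert (Hcos : forall t, is_derive (fun s => r * cos s) t (r * - sin t)).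
  { intros t; auto_derive; auto; ring. }
  assert (Hsin : forall t, is_derive (fun s => r * sin s) t (r * cos t)).
  { intros t; auto_derive; auto; ring. }
  split; intros t; simpl; apply (ex_derive_continuous (V := R_NormedModule)); eexists.
  - exact (cauchy_riemann_path u v ux vx _ _ t _ _ H (Hc t) (Hcos t) (Hsin t)).
  - exact (cauchy_riemann_path _ _ _ _ _ _ t _ _
      (cauchy_riemann_rot _ _ _ _ H) (Hc t) (Hcos t) (Hsin t)).
Qed.

(** Cauchy's formula followed by the kernel expansion. The integrals depend on [r] but not on the
    point, so they can serve as coefficients. *)
Lemma cauchy_riemann_series (u v ux vx : R -> R -> R) (r x y : R) :
  cauchy_riemann u v ux vx -> r < 1 -> Cmod (x, y) < r ->
  let F t : C := (u (r * cos t) (r * sin t), v (r * cos t) (r * sin t)) in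
  is_series (fun k =>
    fst ((x, y) ^ k)%C * RInt (fun t => fst (F t * (/ circle r t) ^ k)%C) 0 (2 * PI)
    - snd ((x, y) ^ k)%C * RInt (fun t => snd (F t * (/ circle r t) ^ k)%C) 0 (2 * PI))
    (2 * PI * u x y).
Proof.
  intros H Hr1 Hz F.
  assert (Hr : 0 < r) by (assert (Hm := Cmod_ge_0 (x, y)); lra).
  assert (HF : Ccontinuous F).
  { apply (cauchy_riemann_circle u v ux vx); auto; lra. }
  rewrite <- (RInt_const_kernel r (x, y) (u x y, v x y) Hz : _ = 2 * PI * u x y).
  destruct (Ccontinuous_kernel r (x, y) Hz) as [CK1 CK2].
  assert (HK : forall t, ((circle r t - (x, y)) * cauchy_kernel r (x, y) t = circle r t)%C).
  { intros t; unfold cauchy_kernel; field. now apply circle_neq. }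
  rewrite (RInt_ext _ (fun t => u x y * fst (cauchy_kernel r (x, y) t)
    - v x y * snd (cauchy_kernel r (x, y) t))) by reflexivity.
  rewrite <- (cauchy_homotopy u v ux vx x y r
    (fun t => fst (cauchy_kernel r (x, y) t)) (fun t => snd (cauchy_kernel r (x, y) t)));
    auto.
  - now apply cauchy_kernel_series.
  - lra.
  - rewrite <- (pow2_sqrt (x ^ 2 + y ^ 2)) by nra.
    apply pow_incr; split; [apply sqrt_pos | now apply Rlt_le].
  - intros t. exact (f_equal fst (HK t)).
  - intros t. exact (f_equal snd (HK t)).
Qed.

Lemma cauchy_riemann_expansion (u v ux vx : R -> R -> R) (r : R) :
  cauchy_riemann u v ux vx -> r < 1 ->
  exists a b : nat -> R, forall x y, Cmod (x, y) < r ->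
    is_series (fun k => fst ((x, y) ^ k)%C * a k - snd ((x, y) ^ k)%C * b k) (u x y) /\
    is_series (fun k => fst ((x, y) ^ k)%C * b k + snd ((x, y) ^ k)%C * a k) (v x y).
Proof.
  intros H Hr.
  pose (F t := (u (r * cos t) (r * sin t), v (r * cos t) (r * sin t)) : C).
  pose (A k := RInt (fun t => fst (F t * (/ circle r t) ^ k)%C) 0 (2 * PI)).
  pose (B k := RInt (fun t => snd (F t * (/ circle r t) ^ k)%C) 0 (2 * PI)).
  exists (fun k => / (2 * PI) * A k), (fun k => / (2 * PI) * B k); intros x y Hz.
  assert (Hpi := PI_neq0).
  split.
  - assert (Hs := cauchy_riemann_series u v ux vx r x y H Hr Hz).
    apply (is_series_scal (/ (2 * PI))) in Hs.
    replace (u x y) with (/ (2 * PI) * (2 * PI * u x y)) by (now field).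
    revert Hs; apply is_series_ext; intros k.
    change (/ (2 * PI) * (fst ((x, y) ^ k)%C * A k - snd ((x, y) ^ k)%C * B k)
      = fst ((x, y) ^ k)%C * (/ (2 * PI) * A k) - snd ((x, y) ^ k)%C * (/ (2 * PI) * B k)).
    ring.
  - assert (Hs := cauchy_riemann_series _ _ _ _ r x y (cauchy_riemann_rot _ _ _ _ H) Hr Hz).
    apply (is_series_scal (/ (2 * PI))) in Hs.
    replace (v x y) with (/ (2 * PI) * (2 * PI * v x y)) by (now field).
    revert Hs; apply is_series_ext; intros k.
    set (F' := fun t => (v (r * cos t) (r * sin t), - u (r * cos t) (r * sin t)) : C).
    assert (HF : Ccontinuous (fun t => F t * (/ circle r t) ^ k)%C).
    { assert (Hm := Cmod_ge_0 (x, y)).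
      apply Ccontinuous_mult_circle_inv; [lra|].
      apply (cauchy_riemann_circle u v ux vx); auto; lra. }
    (* The rotated pair is [-i F], so its coefficients are [-i (A + i B) = B - i A]: the series of
       [v] uses the same two sequences as that of [u]. *)
    assert (HF' : forall t, (F' t * (/ circle r t) ^ k
      = - Ci * (F t * (/ circle r t) ^ k))%C).
    { intros t; replace (F' t) with (- Ci * F t)%C; [ring|].
      apply injective_projections; simpl; ring. }
    assert (E1 : RInt (fun t => fst (F' t * (/ circle r t) ^ k)%C) 0 (2 * PI) = B k).
    { transitivity (RInt (fun t => fst (- Ci * (F t * (/ circle r t) ^ k))%C) 0 (2 * PI)).
      - apply RInt_ext; intros t _; now rewrite HF'.
      - rewrite RInt_Re_scal by auto; unfold A, B; simpl; ring. }
    assert (E2 : RInt (fun t => snd (F' t * (/ circle r t) ^ k)%C) 0 (2 * PI) = - A k).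
    { transitivity (RInt (fun t => snd (- Ci * (F t * (/ circle r t) ^ k))%C) 0 (2 * PI)).
      - apply RInt_ext; intros t _; now rewrite HF'.
      - rewrite RInt_Im_scal by auto; unfold A, B; simpl; ring. }
    change (/ (2 * PI) * (fst ((x, y) ^ k)%C * RInt (fun t => fst (F' t * (/ circle r t) ^ k)%C) 0 (2 * PI)
      - snd ((x, y) ^ k)%C * RInt (fun t => snd (F' t * (/ circle r t) ^ k)%C) 0 (2 * PI))
      = fst ((x, y) ^ k)%C * (/ (2 * PI) * B k) + snd ((x, y) ^ k)%C * (/ (2 * PI) * A k)).
    rewrite E1, E2; ring.
Qed.

(** * Quaternions *)

Definition qdot (p q : quat) : R :=
  let '(a1, b1, c1, d1) := p in
  let '(a2, b2, c2, d2) := q in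
  a1 * a2 + b1 * b2 + c1 * c2 + d1 * d2.

Lemma quat_eq (a b c d a' b' c' d' : R) :
  a = a' -> b = b' -> c = c' -> d = d' -> (a, b, c, d) = (a', b', c', d') :> quat.
Proof. now intros -> -> -> ->. Qed.

Lemma qplus_coord (a b c d a' b' c' d' : R) :
  plus ((a, b, c, d) : quat) ((a', b', c', d') : quat) = (a + a', b + b', c + c', d + d').
Proof. reflexivity. Qed.

Lemma qopp_coord (a b c d : R) :
  opp ((a, b, c, d) : quat) = (- a, - b, - c, - d).
Proof. reflexivity. Qed.

Lemma qscal_coord (x a b c d : R) :
  scal x ((a, b, c, d) : quat) = (x * a, x * b, x * c, x * d).
Proof. reflexivity. Qed.

Ltac qdestruct :=
  repeat match goal with p : quat |- _ => destruct p as [[[? ?] ?] ?] end.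
Ltac qunfold :=
  cbv [qmul qconj qreal qdot qre slice_pt qinv minus];
  repeat (progress (rewrite ?qplus_coord, ?qopp_coord, ?qscal_coord; cbv iota beta)).
Ltac qring :=
  intros; qdestruct; qunfold; first [ring | apply quat_eq; ring].

Lemma qmul_assoc (p q r : quat) : qmul (qmul p q) r = qmul p (qmul q r).
Proof. qring. Qed.

Lemma qmul_1_l (p : quat) : qmul (qreal 1) p = p.
Proof. qring. Qed.

Lemma qmul_1_r (p : quat) : qmul p (qreal 1) = p.
Proof. qring. Qed.

Lemma qmul_0_r (p : quat) : qmul p (qreal 0) = qreal 0.
Proof. qring. Qed.

Lemma qmul_real_comm (a : R) (p : quat) : qmul (qreal a) p = qmul p (qreal a).
Proof. qring. Qed.

Lemma qmul_real_real (a b : R) : qmul (qreal a) (qreal b) = qreal (a * b).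
Proof. qring. Qed.

Lemma qabs_sqr (p : quat) : qabs p ^ 2 = qdot p p.
Proof.
  destruct p as [[[a b] c] d]; unfold qabs, qdot.
  rewrite pow2_sqrt by nra; ring.
Qed.

Lemma qabs_ge_0 (p : quat) : 0 <= qabs p.
Proof. destruct p as [[[a b] c] d]; apply sqrt_pos. Qed.

Lemma qabs_eq_sqr (p q : quat) : qdot p p = qdot q q -> qabs p = qabs q.
Proof.
  intros H; rewrite <- !qabs_sqr in H.
  apply Rsqr_inj; auto using qabs_ge_0; unfold Rsqr; lra.
Qed.

Lemma qabs_eq_0 (p : quat) : qabs p = 0 -> p = qreal 0.
Proof.
  intros H; assert (H2 := qabs_sqr p); rewrite H in H2.
  destruct p as [[[a b] c] d]; unfold qdot in H2.
  apply quat_eq; nra.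
Qed.

Lemma qabs_gt_0 (p : quat) : p <> qreal 0 -> 0 < qabs p.
Proof.
  intros Hp; destruct (qabs_ge_0 p) as [H | H]; auto.
  now destruct Hp; apply qabs_eq_0.
Qed.

Lemma qabs_mul (p q : quat) : qabs (qmul p q) = qabs p * qabs q.
Proof.
  apply Rsqr_inj; auto using qabs_ge_0, Rmult_le_pos; unfold Rsqr.
  assert (Hp := qabs_sqr p); assert (Hq := qabs_sqr q); assert (Hpq := qabs_sqr (qmul p q)).
  transitivity (qabs (qmul p q) ^ 2); [ring|].
  transitivity (qabs p ^ 2 * qabs q ^ 2); [|ring].
  rewrite Hp, Hq, Hpq; clear; qring.
Qed.

Lemma qabs_conj (p : quat) : qabs (qconj p) = qabs p.
Proof. apply qabs_eq_sqr; qring. Qed.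

Lemma qabs_real (a : R) : qabs (qreal a) = Rabs a.
Proof.
  apply Rsqr_inj; auto using qabs_ge_0, Rabs_pos.
  rewrite <- Rsqr_abs; unfold Rsqr.
  transitivity (qabs (qreal a) ^ 2); [ring|].
  rewrite qabs_sqr; qring.
Qed.

Lemma qabs_pow (p : quat) (n : nat) : qabs (qpow p n) = qabs p ^ n.
Proof.
  induction n as [|n IH].
  - change (qabs (qreal 1) = 1); rewrite qabs_real; apply Rabs_R1.
  - simpl; now rewrite qabs_mul, IH.
Qed.

Lemma qinv_l (p : quat) : p <> qreal 0 -> qmul (qinv p) p = qreal 1.
Proof.
  intros Hp; apply qabs_gt_0 in Hp; unfold qinv.
  transitivity (qreal (/ (qabs p ^ 2) * qdot p p)).
  - generalize (/ (qabs p ^ 2)); intros x; clear Hp; qring.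
  - rewrite <- qabs_sqr; f_equal; field; lra.
Qed.

Lemma qinv_r (p : quat) : p <> qreal 0 -> qmul p (qinv p) = qreal 1.
Proof.
  intros Hp; apply qabs_gt_0 in Hp; unfold qinv.
  transitivity (qreal (/ (qabs p ^ 2) * qdot p p)).
  - generalize (/ (qabs p ^ 2)); intros x; clear Hp; qring.
  - rewrite <- qabs_sqr; f_equal; field; lra.
Qed.

Lemma qreal_1_neq_0 : qreal 1 <> qreal 0.
Proof. intros [= H]; lra. Qed.

Lemma qmul_neq_0 (p q : quat) : p <> qreal 0 -> q <> qreal 0 -> qmul p q <> qreal 0.
Proof.
  intros Hp Hq E; apply qabs_gt_0 in Hp, Hq.
  apply (f_equal qabs) in E; rewrite qabs_mul, qabs_real, Rabs_R0 in E; nra.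
Qed.

Lemma qinv_unique (p q : quat) : qmul p q = qreal 1 -> qinv q = p.
Proof.
  intros E.
  assert (Hq : q <> qreal 0).
  { intros ->; rewrite qmul_0_r in E; now apply qreal_1_neq_0. }
  rewrite <- (qmul_1_l (qinv q)), <- E, qmul_assoc, qinv_r, qmul_1_r; auto.
Qed.

Lemma qinv_mul (p q : quat) :
  p <> qreal 0 -> q <> qreal 0 -> qinv (qmul p q) = qmul (qinv q) (qinv p).
Proof.
  intros Hp Hq; apply qinv_unique.
  now rewrite qmul_assoc, <- (qmul_assoc (qinv p)), qinv_l, qmul_1_l, qinv_l.
Qed.

Lemma qabs_inv (p : quat) : p <> qreal 0 -> qabs (qinv p) = / qabs p.
Proof.
  intros Hp; apply Rmult_eq_reg_r with (qabs p).
  - rewrite <- qabs_mul, qinv_l, qabs_real, Rabs_R1, Rinv_l; auto.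
    apply qabs_gt_0 in Hp; lra.
  - apply qabs_gt_0 in Hp; lra.
Qed.

Lemma qabs_conjugation (p q : quat) :
  p <> qreal 0 -> qabs (qmul (qinv p) (qmul q p)) = qabs q.
Proof.
  intros Hp; rewrite !qabs_mul, qabs_inv by auto.
  apply qabs_gt_0 in Hp; field; lra.
Qed.

(** The rule for carrying a factor [p] across [q^n]; it is the source of the conjugated argument in
    [reg_mul_eval]. *)
Lemma qpow_conjugation (p q : quat) (n : nat) :
  p <> qreal 0 -> qmul p (qpow (qmul (qinv p) (qmul q p)) n) = qmul (qpow q n) p.
Proof.
  intros Hp; induction n as [|n IH]; cbn [qpow Nat.add pow].
  - now rewrite qmul_1_l, qmul_1_r.
  - rewrite !qmul_assoc, <- (qmul_assoc p (qinv p)), qinv_r, qmul_1_l by auto.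
    now rewrite IH.
Qed.

Lemma qpow_add (q : quat) (m n : nat) : qpow q (m + n) = qmul (qpow q m) (qpow q n).
Proof.
  induction m as [|m IH]; cbn [qpow Nat.add pow].
  - now rewrite qmul_1_l.
  - now rewrite IH, qmul_assoc.
Qed.

Lemma qpow_comm (q : quat) (n : nat) : qmul (qpow q n) q = qmul q (qpow q n).
Proof.
  induction n as [|n IH]; cbn [qpow Nat.add pow].
  - now rewrite qmul_1_l, qmul_1_r.
  - now rewrite qmul_assoc, IH.
Qed.

Lemma qpow_real (x : R) (n : nat) : qpow (qreal x) n = qreal (x ^ n).
Proof.
  induction n as [|n IH]; cbn [qpow pow]; auto.
  now rewrite IH, qmul_real_real.
Qed.

Lemma qdot_ext (p q : quat) : (forall c, qdot c p = qdot c q) -> p = q.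
Proof.
  intros H.
  assert (H0 := H (1, 0, 0, 0)); assert (H1 := H (0, 1, 0, 0)).
  assert (H2 := H (0, 0, 1, 0)); assert (H3 := H (0, 0, 0, 1)).
  destruct p as [[[a b] c] d]; destruct q as [[[a' b'] c'] d'].
  unfold qdot in *; apply quat_eq; lra.
Qed.

Lemma qdot_mul_l (c p u : quat) : qdot c (qmul p u) = qdot (qmul (qconj p) c) u.
Proof. qring. Qed.

Lemma qdot_mul_r (c p u : quat) : qdot c (qmul u p) = qdot (qmul c (qconj p)) u.
Proof. qring. Qed.

Lemma qdot_conj (c u : quat) : qdot c (qconj u) = qdot (qconj c) u.
Proof. qring. Qed.

Lemma qdot_plus (c u v : quat) : qdot c (plus u v) = qdot c u + qdot c v.
Proof. qring. Qed.

Lemma qdot_le (c p : quat) : Rabs (qdot c p) <= qabs c * qabs p.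
Proof.
  apply Rsqr_incr_0; auto using Rabs_pos, Rmult_le_pos, qabs_ge_0.
  rewrite <- Rsqr_abs; unfold Rsqr.
  replace (qabs c * qabs p * (qabs c * qabs p)) with (qabs c ^ 2 * qabs p ^ 2) by ring.
  rewrite !qabs_sqr; destruct c as [[[a b] c] d]; destruct p as [[[a' b'] c'] d']; unfold qdot.
  (* Lagrange's identity: the two sides differ by the sum of the squares of these six minors. *)
  assert (H1 := pow2_ge_0 (a * b' - b * a')); assert (H2 := pow2_ge_0 (a * c' - c * a')).
  assert (H3 := pow2_ge_0 (a * d' - d * a')); assert (H4 := pow2_ge_0 (b * c' - c * b')).
  assert (H5 := pow2_ge_0 (b * d' - d * b')); assert (H6 := pow2_ge_0 (c * d' - d * c')).
  lra.
Qed.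

(** * Series of quaternions *)

(** [is_linear] contains a norm bound, hence continuity: limits and derivatives pass through
    [qdot c]. Building it from projections yields that bound for the product norm. *)
Lemma is_linear_qdot (c : quat) : is_linear (qdot c : quat -> R).
Proof.
  destruct c as [[[a b] c] d].
  assert (Hs : forall k, is_linear (fun x : R => scal k x)).
  { intros k; apply (is_linear_scal_r (V := R_NormedModule)); apply Rmult_comm. }
  apply is_linear_ext with (fun q : quat =>
    plus (plus (plus (scal a (fst (fst (fst q)))) (scal b (snd (fst (fst q)))))
               (scal c (snd (fst q)))) (scal d (snd q))).
  { intros [[[x y] z] t]; reflexivity. }
  assert (Hp : forall f g : quat -> R, is_linear f -> is_linear g ->
    is_linear (fun q => plus (f q) (g q))).
  { intros f g Hf Hg.
    apply (is_linear_comp (fun q => (f q, g q)) (fun x : R * R => plus (fst x) (snd x))).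
    - now apply is_linear_prod.
    - exact is_linear_plus. }
  assert (H1 : is_linear (fun q : quat => fst q)) by exact is_linear_fst.
  assert (H2 : is_linear (fun q : quat => fst (fst q))).
  { exact (is_linear_comp _ _ H1 is_linear_fst). }
  repeat apply Hp.
  - exact (is_linear_comp _ _ (is_linear_comp _ _ H2 is_linear_fst) (Hs a)).
  - exact (is_linear_comp _ _ (is_linear_comp _ _ H2 is_linear_snd) (Hs b)).
  - exact (is_linear_comp _ _ (is_linear_comp _ _ H1 is_linear_snd) (Hs c)).
  - exact (is_linear_comp _ _ is_linear_snd (Hs d)).
Qed.

(* Convergence against every linear functional: left and right multiplications
   and conjugation are moved to the functional by adjunction. *)
Definition qsum (u : nat -> quat) (l : quat) : Prop :=
  forall c, is_series (fun n => qdot c (u n)) (qdot c l).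

Lemma qdot_sum_n (c : quat) (u : nat -> quat) (n : nat) :
  qdot c (sum_n u n) = sum_n (fun k => qdot c (u k)) n.
Proof.
  induction n as [|n IH].
  - now rewrite !sum_O.
  - now rewrite !sum_Sn, qdot_plus, IH.
Qed.

Lemma is_series_qsum (u : nat -> quat) (l : quat) : is_series u l -> qsum u l.
Proof.
  intros H c; unfold is_series.
  apply filterlim_ext with (fun n => qdot c (sum_n u n)).
  { intros n; apply qdot_sum_n. }
  eapply filterlim_comp; [exact H|].
  exact (linear_cont _ _ (is_linear_qdot c)).
Qed.

Lemma is_series_pair {U V : NormedModule R_AbsRing} (u : nat -> U) (v : nat -> V) (l : U) (m : V) :
  is_series u l -> is_series v m -> is_series (fun n => (u n, v n)) (l, m).
Proof.
  intros Hu Hv; unfold is_series.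
  apply filterlim_ext with (fun n => (sum_n u n, sum_n v n)).
  { intros n; induction n as [|n IH].
    - now rewrite !sum_O.
    - now rewrite !sum_Sn, <- IH. }
  refine (proj2 (filterlim_locally (F := eventually)
    (U := prod_UniformSpace U V) _ (l, m)) _); intros e.
  assert (Hu' := proj1 (filterlim_locally (sum_n u) l) Hu).
  assert (Hv' := proj1 (filterlim_locally (sum_n v) m) Hv).
  generalize (filter_and _ _ (Hu' e) (Hv' e)); apply filter_imp.
  intros n [H1 H2]; split; assumption.
Qed.

Lemma qsum_is_series (u : nat -> quat) (l : quat) : qsum u l -> is_series u l.
Proof.
  intros H.
  apply is_series_ext with (fun n => (qdot (1, 0, 0, 0) (u n), qdot (0, 1, 0, 0) (u n),
    qdot (0, 0, 1, 0) (u n), qdot (0, 0, 0, 1) (u n))).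
  { intros n; destruct (u n) as [[[a b] c] d]; unfold qdot; apply quat_eq; ring. }
  replace l with (qdot (1, 0, 0, 0) l, qdot (0, 1, 0, 0) l,
    qdot (0, 0, 1, 0) l, qdot (0, 0, 0, 1) l).
  2:{ destruct l as [[[a b] c] d]; unfold qdot; apply quat_eq; ring. }
  repeat apply (@is_series_pair); apply H.
Qed.

Lemma qsum_qSeries (u : nat -> quat) (l : quat) : qsum u l -> qSeries u = l.
Proof.
  intros H; destruct l as [[[l0 l1] l2] l3].
  assert (Hc : forall c (v : nat -> R) m, qdot c (l0, l1, l2, l3) = m ->
    (forall n, qdot c (u n) = v n) -> Series v = m).
  { intros c v m <- Hv; apply is_series_unique.
    generalize (H c); now apply is_series_ext. }
  unfold qSeries; apply quat_eq;
    [apply (Hc (1, 0, 0, 0)) | apply (Hc (0, 1, 0, 0))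
    | apply (Hc (0, 0, 1, 0)) | apply (Hc (0, 0, 0, 1))];
    try (intros n; destruct (u n) as [[[a b] c] d]); unfold qdot; ring.
Qed.

Lemma qsum_unique (u : nat -> quat) (l m : quat) : qsum u l -> qsum u m -> l = m.
Proof. intros Hl Hm; rewrite <- (qsum_qSeries u l Hl); now apply qsum_qSeries. Qed.

Lemma qsum_ext (u v : nat -> quat) (l : quat) :
  (forall n, u n = v n) -> qsum u l -> qsum v l.
Proof.
  intros Huv H c; generalize (H c); apply is_series_ext; intros n; now rewrite Huv.
Qed.

Lemma qsum_mul_l (p : quat) (u : nat -> quat) (l : quat) :
  qsum u l -> qsum (fun n => qmul p (u n)) (qmul p l).
Proof.
  intros H c; rewrite qdot_mul_l.
  generalize (H (qmul (qconj p) c)); apply is_series_ext; intros n; now rewrite qdot_mul_l.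
Qed.

Lemma qsum_mul_r (p : quat) (u : nat -> quat) (l : quat) :
  qsum u l -> qsum (fun n => qmul (u n) p) (qmul l p).
Proof.
  intros H c; rewrite qdot_mul_r.
  generalize (H (qmul c (qconj p))); apply is_series_ext; intros n; now rewrite qdot_mul_r.
Qed.

Lemma qsum_conj (u : nat -> quat) (l : quat) :
  qsum u l -> qsum (fun n => qconj (u n)) (qconj l).
Proof.
  intros H c; rewrite qdot_conj.
  generalize (H (qconj c)); apply is_series_ext; intros n; now rewrite qdot_conj.
Qed.

Lemma qsum_plus (u v : nat -> quat) (l m : quat) :
  qsum u l -> qsum v m -> qsum (fun n => plus (u n) (v n)) (plus l m).
Proof.
  intros Hu Hv c; rewrite qdot_plus.
  apply is_series_ext with (fun n => plus (qdot c (u n)) (qdot c (v n))).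
  - intros n; now rewrite qdot_plus.
  - now apply (is_series_plus (V := R_NormedModule)).
Qed.

Lemma ex_series_qdot (c : quat) (u : nat -> quat) :
  ex_series (fun n => qabs (u n)) -> ex_series (fun n => Rabs (qdot c (u n))).
Proof.
  intros H.
  apply (ex_series_le (K := R_AbsRing) (V := R_CompleteNormedModule) _ (fun n => qabs c * qabs (u n))).
  - intros n; change (Rabs (Rabs (qdot c (u n))) <= qabs c * qabs (u n)).
    rewrite Rabs_Rabsolu; apply qdot_le.
  - now apply (ex_series_scal (K := R_AbsRing) (V := R_NormedModule) (qabs c)).
Qed.

Lemma ex_series_qsum (u : nat -> quat) :
  ex_series (fun n => qabs (u n)) -> exists l, qsum u l.
Proof.
  intros H.
  assert (Hc : forall c, exists m, is_series (fun n => qdot c (u n)) m).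
  { intros c; apply ex_series_Rabs, ex_series_qdot, H. }
  destruct (Hc (1, 0, 0, 0)) as [l0 H0]; destruct (Hc (0, 1, 0, 0)) as [l1 H1].
  destruct (Hc (0, 0, 1, 0)) as [l2 H2]; destruct (Hc (0, 0, 0, 1)) as [l3 H3].
  exists (l0, l1, l2, l3); apply is_series_qsum.
  apply is_series_ext with (fun n => (qdot (1, 0, 0, 0) (u n), qdot (0, 1, 0, 0) (u n),
    qdot (0, 0, 1, 0) (u n), qdot (0, 0, 0, 1) (u n))).
  { intros n; destruct (u n) as [[[a b] c] d]; unfold qdot; apply quat_eq; ring. }
  repeat apply (@is_series_pair); assumption.
Qed.

Lemma is_series_conv (a b : nat -> R) (la lb : R) :
  is_series a la -> is_series b lb ->
  ex_series (fun n => Rabs (a n)) -> ex_series (fun n => Rabs (b n)) ->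
  is_series (fun n => sum_n (fun k => a k * b (n - k)%nat) n) (la * lb).
Proof.
  intros Ha Hb Ha' Hb'; generalize (is_series_mult a b la lb Ha Hb Ha' Hb').
  apply is_series_ext; intros n; now rewrite sum_n_Reals.
Qed.

(** * Power series expansion of slice regular functions *)

Lemma is_series_bounded (a : nat -> R) (l : R) :
  is_series a l -> exists M, 0 <= M /\ forall n, Rabs (a n) <= M.
Proof.
  intros H.
  assert (H0 : is_lim_seq a 0) by (apply ex_series_lim_0; now exists l).
  destruct (proj2 (is_lim_seq_spec a (Finite 0)) H0 (mkposreal 1 Rlt_0_1)) as [N HN]; simpl in HN.
  assert (HP : forall K, exists M, 0 <= M /\ forall n, (n < K)%nat -> Rabs (a n) <= M).
  { induction K as [|K [M [HM IH]]].
    - exists 0; split; [lra|]; intros; lia.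
    - exists (M + Rabs (a K)); assert (HK := Rabs_pos (a K)); split; [lra|].
      intros n Hn; destruct (Nat.eq_dec n K) as [-> | Hne]; [lra|].
      specialize (IH n ltac:(lia)); lra. }
  destruct (HP N) as [M [HM HMn]].
  exists (M + 1); split; [lra|]; intros n.
  destruct (Nat.lt_ge_cases n N) as [Hn | Hn].
  - specialize (HMn n Hn); lra.
  - specialize (HN n Hn); rewrite Rminus_0_r in HN; lra.
Qed.

(** Convergence at [r / 2] bounds the terms there, so both radii are positive and the coefficients
    are determined by the sum near 0. *)
Lemma real_power_series_unique (a b : nat -> R) (h : R -> R) (r : R) :
  0 < r ->
  (forall x, Rabs x < r -> is_series (fun n => x ^ n * a n) (h x)) ->
  (forall x, Rabs x < r -> is_series (fun n => x ^ n * b n) (h x)) ->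
  forall n, a n = b n.
Proof.
  intros Hr Ha Hb n.
  assert (Hrad : forall c, (forall x, Rabs x < r -> is_series (fun n => x ^ n * c n) (h x)) ->
    Rbar_lt 0 (CV_radius c)).
  { intros c Hc.
    apply Rbar_lt_le_trans with (r / 2); [simpl; lra|].
    apply CV_radius_bounded.
    destruct (is_series_bounded _ _ (Hc (r / 2) ltac:(rewrite Rabs_pos_eq; lra))) as [M [_ HM]].
    exists M; intros k; rewrite Rmult_comm; apply HM. }
  assert (Hsum : forall c, (forall x, Rabs x < r -> is_series (fun n => x ^ n * c n) (h x)) ->
    forall x, Rabs x < r -> PSeries c x = h x).
  { intros c Hc x Hx; apply is_series_unique.
    generalize (Hc x Hx); apply is_series_ext; intros k; apply Rmult_comm. }
  apply PSeries_ext_recip; auto.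
  exists (mkposreal r Hr); intros x Hx.
  assert (Hx' : Rabs x < r).
  { replace x with (x - 0) by ring; exact Hx. }
  now rewrite (Hsum a Ha), (Hsum b Hb).
Qed.

Lemma qdot_qpow_real (c : quat) (x : R) (n : nat) (p : quat) :
  qdot c (qmul (qpow (qreal x) n) p) = x ^ n * qdot c p.
Proof. rewrite qpow_real; generalize (x ^ n); qring. Qed.

(** Powers of a real point are real, so each functional [qdot c] turns the expansion into a real
    power series. All slices share the real axis, which makes this the tool for comparing them. *)
Lemma real_axis_expansion_unique (a b : nat -> quat) (h : R -> quat) (r : R) :
  0 < r ->
  (forall x, Rabs x < r -> qsum (fun n => qmul (qpow (qreal x) n) (a n)) (h x)) ->
  (forall x, Rabs x < r -> qsum (fun n => qmul (qpow (qreal x) n) (b n)) (h x)) ->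
  forall n, a n = b n.
Proof.
  intros Hr Ha Hb n; apply qdot_ext; intros c.
  apply (real_power_series_unique (fun n => qdot c (a n)) (fun n => qdot c (b n))
    (fun x => qdot c (h x)) r Hr); intros x Hx.
  - generalize (Ha x Hx c); apply is_series_ext; intros k; apply qdot_qpow_real.
  - generalize (Hb x Hx c); apply is_series_ext; intros k; apply qdot_qpow_real.
Qed.

(** * Slices as copies of the complex plane *)

Lemma imag_unit_coord (I : quat) :
  imag_unit I -> exists b c d, I = (0, b, c, d) /\ b ^ 2 + c ^ 2 + d ^ 2 = 1.
Proof.
  destruct I as [[[a b] c] d]; unfold imag_unit, qmul, qreal; intros [= H0 H1 H2 H3].
  (* The imaginary part of [I^2] is [2 a (b, c, d) = 0]; if [a] were nonzero, the real part would
     read [a^2 = -1]. *)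
  assert (Ha : a = 0) by nra.
  subst a; exists b, c, d; split; auto; nra.
Qed.

Lemma qabs_slice_pt (I : quat) (x y : R) :
  imag_unit I -> qabs (slice_pt I x y) = Cmod (x, y).
Proof.
  intros HI; destruct (imag_unit_coord I HI) as [b [c [d [-> H]]]].
  unfold slice_pt, Cmod, qabs, qmul, qreal; rewrite qplus_coord; simpl fst; simpl snd.
  f_equal; transitivity (x ^ 2 + y ^ 2 * (b ^ 2 + c ^ 2 + d ^ 2)); [ring|].
  rewrite H; ring.
Qed.

Lemma qmul_imag_unit (I p : quat) : imag_unit I -> qmul I (qmul I p) = opp p.
Proof.
  intros HI; rewrite <- qmul_assoc, HI; qring.
Qed.

(** Since [I^2 = -1], sending [x + i y] to [x + y I] is multiplicative, so powers on a slice are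
    computed in [C]. *)
Lemma qpow_slice_pt (I : quat) (x y : R) (n : nat) :
  imag_unit I ->
  qpow (slice_pt I x y) n = slice_pt I (fst ((x, y) ^ n)%C) (snd ((x, y) ^ n)%C).
Proof.
  intros HI; induction n as [|n IH].
  - simpl; clear HI; qring.
  - cbn [qpow]; rewrite IH, Cpow_S; destruct ((x, y) ^ n)%C as [s t].
    destruct (imag_unit_coord I HI) as [b [c [d [-> H]]]].
    unfold Cmult; cbn [fst snd]; unfold slice_pt, qmul, qreal; rewrite !qplus_coord.
    apply quat_eq; [|ring..].
    transitivity (x * s - y * t * (b ^ 2 + c ^ 2 + d ^ 2)); [ring|].
    rewrite H; ring.
Qed.

Lemma slice_pt_surjective (q : quat) :
  exists I x y, imag_unit I /\ q = slice_pt I x y.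
Proof.
  destruct q as [[[a b] c] d].
  destruct (Req_dec (b ^ 2 + c ^ 2 + d ^ 2) 0) as [H0 | H0].
  (* A real quaternion lies on every slice; [i] is an arbitrary choice. *)
  - exists (0, 1, 0, 0), a, 0; split.
    + unfold imag_unit; qring.
    + unfold slice_pt, qmul, qreal; rewrite qplus_coord; apply quat_eq; nra.
  - set (s := sqrt (b ^ 2 + c ^ 2 + d ^ 2)).
    assert (Hs2 : s * s = b ^ 2 + c ^ 2 + d ^ 2) by (apply sqrt_sqrt; nra).
    assert (Hs : s <> 0) by (intros E; rewrite E in Hs2; lra).
    exists (0, b / s, c / s, d / s), a, s; split.
    + unfold imag_unit, qmul, qreal; apply quat_eq; try (field; auto).
      transitivity (- ((b ^ 2 + c ^ 2 + d ^ 2) / (s * s))); [field; auto|].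
      rewrite <- Hs2; field; auto.
    + unfold slice_pt, qmul, qreal; rewrite qplus_coord; apply quat_eq; field; auto.
Qed.

Lemma is_derive_qdot (c : quat) (f : R -> quat) (x : R) (l : quat) :
  is_derive f x l -> is_derive (fun t => qdot c (f t)) x (qdot c l).
Proof.
  intros Hf; unfold is_derive in *.
  apply filterdiff_ext_lin with (fun t => qdot c (scal t l)).
  - apply (filterdiff_comp' f (qdot c) x (fun t => scal t l) (qdot c)); auto.
    exact (filterdiff_linear _ (is_linear_qdot c)).
  - intros t; exact (linear_scal _ (is_linear_qdot c) t l).
Qed.

(* The functional <I c, -> is the conjugate harmonic partner of <c, -> because
   the adjoint of left multiplication by I is left multiplication by -I. *)
Lemma slice_cauchy_riemann (f : quat -> quat) (I c : quat) (Dx Dy : R * R -> quat) :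
  imag_unit I ->
  (forall x y : R, in_ball (slice_pt I x y) ->
    is_derive (fun t : R => f (slice_pt I t y)) x (Dx (x, y)) /\
    is_derive (fun t : R => f (slice_pt I x t)) y (Dy (x, y)) /\
    continuous Dx (x, y) /\
    continuous Dy (x, y) /\
    scal (1 / 2) (plus (Dx (x, y)) (qmul I (Dy (x, y)))) = qreal 0) ->
  cauchy_riemann (fun x y => qdot c (f (slice_pt I x y)))
    (fun x y => qdot (qmul I c) (f (slice_pt I x y)))
    (fun x y => qdot c (Dx (x, y))) (fun x y => qdot (qmul I c) (Dx (x, y))).
Proof.
  intros HI H x y Hxy.
  destruct (H x y) as [Hx [Hy [Cx [_ E]]]].
  { unfold in_ball; rewrite qabs_slice_pt by auto; unfold Cmod; simpl fst; simpl snd.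
    rewrite <- sqrt_1; apply sqrt_lt_1; nra. }
  (* Left multiplication of [Dx + I Dy = 0] by [I] isolates [Dy]. *)
  assert (ED : Dy (x, y) = qmul I (Dx (x, y))).
  { assert (E' : Dx (x, y) = opp (qmul I (Dy (x, y)))).
    { revert E; generalize (Dx (x, y)) (qmul I (Dy (x, y))); clear.
      intros p q; qdestruct; qunfold; intros [= H0 H1 H2 H3]; apply quat_eq; lra. }
    rewrite E'.
    transitivity (opp (qmul I (qmul I (Dy (x, y))))).
    - rewrite qmul_imag_unit by auto; clear; generalize (Dy (x, y)); qring.
    - generalize (qmul I (Dy (x, y))); clear; qring. }
  destruct (imag_unit_coord I HI) as [b1 [c1 [d1 [EI HI1]]]].
  assert (E1 : qdot c (Dy (x, y)) = - qdot (qmul I c) (Dx (x, y))).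
  { rewrite ED, EI; clear; generalize (Dx (x, y)); qring. }
  (* Left multiplication by the unit [I] is an isometry. *)
  assert (E2 : qdot (qmul I c) (Dy (x, y)) = qdot c (Dx (x, y))).
  { transitivity ((b1 ^ 2 + c1 ^ 2 + d1 ^ 2) * qdot c (Dx (x, y))).
    - rewrite ED, EI; clear; generalize (Dx (x, y)); qring.
    - rewrite HI1; ring. }
  split; [|split]; split.
  - now apply (is_derive_qdot c (fun t => f (slice_pt I t y))).
  - rewrite <- E1; now apply (is_derive_qdot c (fun t => f (slice_pt I x t))).
  - now apply (is_derive_qdot _ (fun t => f (slice_pt I t y))).
  - rewrite <- E2; now apply (is_derive_qdot _ (fun t => f (slice_pt I x t))).
  - apply continuity_2d_pt_filterlim.
    apply continuous_ext with (fun z => qdot c (Dx z)); [now intros [? ?]|].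
    apply (continuous_comp Dx (qdot c)); auto.
    exact (linear_cont _ _ (is_linear_qdot c)).
  - apply continuity_2d_pt_filterlim.
    apply continuous_ext with (fun z => qdot (qmul I c) (Dx z)); [now intros [? ?]|].
    apply (continuous_comp Dx (qdot (qmul I c))); auto.
    exact (linear_cont _ _ (is_linear_qdot _)).
Qed.

Lemma slice_pt_real (I : quat) (x : R) : slice_pt I x 0 = qreal x.
Proof. qring. Qed.

Lemma Cpow_real (x : R) (n : nat) : ((x, 0) ^ n)%C = (x ^ n, 0).
Proof.
  induction n as [|n IH]; [reflexivity|].
  rewrite Cpow_S, IH; apply injective_projections; simpl; ring.
Qed.

Lemma Cmod_real (x : R) : Cmod (x, 0) = Rabs x.
Proof. exact (Cmod_R x). Qed.

(** This has the shape [Re ((s + i t) (a + i b))] with [a = qdot c p] and [b = qdot (qmul I c) p],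
    so it matches the terms of [cauchy_riemann_expansion]. *)
Lemma qdot_slice_pt_mul (I c p : quat) (s t : R) :
  imag_unit I ->
  qdot c (qmul (slice_pt I s t) p) = s * qdot c p - t * qdot (qmul I c) p.
Proof.
  intros HI; destruct (imag_unit_coord I HI) as [b1 [c1 [d1 [-> _]]]].
  clear HI; qring.
Qed.

(** Each functional [c] has its own pair of real sequences, and they must come from one quaternionic
    sequence. On the real axis they expand the values of [qdot c] and [qdot (qmul I c)] on [f]. The
    sequence [al], assembled from the four coordinate functionals, expands [f] there too, so
    uniqueness identifies the pair with [qdot c (al n)] and [qdot (qmul I c) (al n)]. *)
Lemma slice_expansion (f : quat -> quat) (I : quat) (r : R) :
  slice_regular f -> imag_unit I -> 0 < r < 1 ->
  exists a : nat -> quat, forall x y, Cmod (x, y) < r ->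
    qsum (fun n => qmul (qpow (slice_pt I x y) n) (a n)) (f (slice_pt I x y)).
Proof.
  intros Hf HI Hr.
  destruct (Hf I HI) as [Dx [Dy HD]].
  assert (Hexp := fun c => cauchy_riemann_expansion _ _ _ _ r
    (slice_cauchy_riemann f I c Dx Dy HI HD) (proj2 Hr)); clear HD.
  assert (Hreal : forall c, exists a b : nat -> R,
    (forall x y, Cmod (x, y) < r -> is_series
      (fun k => fst ((x, y) ^ k)%C * a k - snd ((x, y) ^ k)%C * b k)
      (qdot c (f (slice_pt I x y)))) /\
    (forall x, Rabs x < r -> is_series (fun k => x ^ k * a k) (qdot c (f (qreal x)))) /\
    (forall x, Rabs x < r -> is_series (fun k => x ^ k * b k) (qdot (qmul I c) (f (qreal x))))).
  { intros c; destruct (Hexp c) as [a [b Hab]]; exists a, b; split; [|split].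
    - intros x y Hxy; now apply Hab.
    - intros x Hx; rewrite <- Cmod_real in Hx.
      rewrite <- (slice_pt_real I); generalize (proj1 (Hab x 0 Hx)).
      apply is_series_ext; intros k; rewrite Cpow_real; simpl.
      change (x ^ k * a k - 0 * b k = x ^ k * a k); ring.
    - intros x Hx; rewrite <- Cmod_real in Hx.
      rewrite <- (slice_pt_real I); generalize (proj2 (Hab x 0 Hx)).
      apply is_series_ext; intros k; rewrite Cpow_real; simpl.
      change (x ^ k * b k + 0 * a k = x ^ k * b k); ring. }
  clear Hexp.
  destruct (Hreal (1, 0, 0, 0)) as [a0 [_ [_ [H0 _]]]].
  destruct (Hreal (0, 1, 0, 0)) as [a1 [_ [_ [H1 _]]]].
  destruct (Hreal (0, 0, 1, 0)) as [a2 [_ [_ [H2 _]]]].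
  destruct (Hreal (0, 0, 0, 1)) as [a3 [_ [_ [H3 _]]]].
  set (al := fun n => (a0 n, a1 n, a2 n, a3 n) : quat).
  assert (Hal : forall c x, Rabs x < r ->
    is_series (fun n => x ^ n * qdot c (al n)) (qdot c (f (qreal x)))).
  { intros c x Hx.
    assert (Hq : qsum (fun n => qmul (qpow (qreal x) n) (al n)) (f (qreal x))).
    { apply is_series_qsum.
      apply is_series_ext with (fun n => (x ^ n * a0 n, x ^ n * a1 n, x ^ n * a2 n, x ^ n * a3 n)).
      { intros n; rewrite qpow_real; unfold al; generalize (x ^ n); intros y.
        qunfold; apply quat_eq; ring. }
      replace (f (qreal x)) with (qdot (1, 0, 0, 0) (f (qreal x)), qdot (0, 1, 0, 0) (f (qreal x)),
        qdot (0, 0, 1, 0) (f (qreal x)), qdot (0, 0, 0, 1) (f (qreal x))).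
      2:{ destruct (f (qreal x)) as [[[a b] c'] d]; unfold qdot; apply quat_eq; ring. }
      repeat apply (@is_series_pair); auto. }
    generalize (Hq c); apply is_series_ext; intros n; apply qdot_qpow_real. }
  exists al; intros x y Hxy c.
  destruct (Hreal c) as [a [b [Hab [Ha Hb]]]].
  assert (Ea := real_power_series_unique _ _ _ r (proj1 Hr) Ha (Hal c)).
  assert (Eb := real_power_series_unique _ _ _ r (proj1 Hr) Hb (Hal (qmul I c))).
  generalize (Hab x y Hxy); apply is_series_ext; intros n.
  now rewrite qpow_slice_pt, qdot_slice_pt_mul, Ea, Eb.
Qed.

Lemma slice_regular_expansion (f : quat -> quat) :
  slice_regular f -> exists a, is_expansion f a.
Proof.
  intros Hf.
  assert (Hi : imag_unit (0, 1, 0, 0)) by (unfold imag_unit; qring).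
  (* The slice of [i] with radius 1/2 fixes the coefficients once and for all. *)
  destruct (slice_expansion f _ (1 / 2) Hf Hi ltac:(lra)) as [a Ha].
  exists a; intros q Hq; apply qsum_is_series.
  destruct (slice_pt_surjective q) as [I [x [y [HI ->]]]].
  unfold in_ball in Hq; rewrite qabs_slice_pt in Hq by auto.
  assert (Hm := Cmod_ge_0 (x, y)).
  (* This radius exceeds [|q|] and is at least 1/2, so the new expansion reaches [q] and shares the
     real interval of radius 1/2 with the reference one. *)
  destruct (slice_expansion f I ((1 + Cmod (x, y)) / 2) Hf HI ltac:(lra)) as [b Hb].
  assert (Hab : forall n, b n = a n).
  { apply (real_axis_expansion_unique b a (fun x => f (qreal x)) (1 / 2)); [lra|..].
    - intros t Ht; rewrite <- (slice_pt_real I); apply Hb; rewrite Cmod_real; lra.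
    - intros t Ht; rewrite <- (slice_pt_real (0, 1, 0, 0)).
      apply Ha; rewrite Cmod_real; lra. }
  apply qsum_ext with (fun n => qmul (qpow (slice_pt I x y) n) (b n)).
  { intros n; now rewrite Hab. }
  apply Hb; lra.
Qed.

Lemma expansion_unique (f : quat -> quat) (a b : nat -> quat) :
  is_expansion f a -> is_expansion f b -> forall n, a n = b n.
Proof.
  intros Ha Hb.
  apply (real_axis_expansion_unique a b (fun x => f (qreal x)) 1); [lra|..];
    intros x Hx; apply is_series_qsum; [apply Ha | apply Hb];
    unfold in_ball; now rewrite qabs_real.
Qed.

(** The existence of [a] makes [epsilon] return a genuine expansion, and uniqueness identifies it
    with [a]. *)
Lemma coeffs_eq (f : quat -> quat) (a : nat -> quat) :
  is_expansion f a -> forall n, coeffs f n = a n.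
Proof.
  intros Ha; apply (expansion_unique f); auto.
  exact (epsilon_spec _ (is_expansion f) (ex_intro _ a Ha)).
Qed.

Lemma coeffs_expansion (f : quat -> quat) :
  slice_regular f -> is_expansion f (coeffs f).
Proof. intros Hf; exact (epsilon_spec _ _ (slice_regular_expansion f Hf)). Qed.

(** * Absolute convergence inside the ball and the Cauchy product *)

Definition abs_conv (a : nat -> quat) : Prop :=
  forall r, 0 <= r < 1 -> ex_series (fun n => r ^ n * qabs (a n)).

Lemma qabs_le_coords (p : quat) :
  qabs p <= Rabs (qdot (1, 0, 0, 0) p) + Rabs (qdot (0, 1, 0, 0) p)
    + Rabs (qdot (0, 0, 1, 0) p) + Rabs (qdot (0, 0, 0, 1) p).
Proof.
  destruct p as [[[a b] c] d].
  replace (qdot (1, 0, 0, 0) (a, b, c, d)) with a by (unfold qdot; ring).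
  replace (qdot (0, 1, 0, 0) (a, b, c, d)) with b by (unfold qdot; ring).
  replace (qdot (0, 0, 1, 0) (a, b, c, d)) with c by (unfold qdot; ring).
  replace (qdot (0, 0, 0, 1) (a, b, c, d)) with d by (unfold qdot; ring).
  assert (Ha := Rabs_pos a); assert (Hb := Rabs_pos b).
  assert (Hc := Rabs_pos c); assert (Hd := Rabs_pos d).
  apply Rsqr_incr_0; [|apply qabs_ge_0|lra].
  unfold Rsqr; transitivity (qabs (a, b, c, d) ^ 2); [right; ring|].
  rewrite qabs_sqr; unfold qdot.
  assert (Ha2 := Rsqr_abs a); assert (Hb2 := Rsqr_abs b).
  assert (Hc2 := Rsqr_abs c); assert (Hd2 := Rsqr_abs d); unfold Rsqr in *.
  nra.
Qed.

Lemma qsum_bounded (u : nat -> quat) (l : quat) :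
  qsum u l -> exists M, 0 <= M /\ forall n, qabs (u n) <= M.
Proof.
  intros H.
  destruct (is_series_bounded _ _ (H (1, 0, 0, 0))) as [M0 [P0 H0]].
  destruct (is_series_bounded _ _ (H (0, 1, 0, 0))) as [M1 [P1 H1]].
  destruct (is_series_bounded _ _ (H (0, 0, 1, 0))) as [M2 [P2 H2]].
  destruct (is_series_bounded _ _ (H (0, 0, 0, 1))) as [M3 [P3 H3]].
  exists (M0 + M1 + M2 + M3); split; [lra|]; intros n.
  specialize (H0 n); specialize (H1 n); specialize (H2 n); specialize (H3 n).
  assert (H4 := qabs_le_coords (u n)); lra.
Qed.

(** Abel's argument: convergence at a real point [s] between [r] and 1 bounds [s^n |a_n|], and the
    geometric series of ratio [r / s] dominates. *)
Lemma expansion_abs_conv (f : quat -> quat) (a : nat -> quat) :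
  is_expansion f a -> abs_conv a.
Proof.
  intros Ha r Hr.
  set (s := (1 + r) / 2).
  assert (Hs : 0 < s < 1 /\ r < s) by (unfold s; lra).
  assert (Hb : in_ball (qreal s)) by (unfold in_ball; rewrite qabs_real, Rabs_pos_eq; lra).
  destruct (qsum_bounded _ _ (is_series_qsum _ _ (Ha _ Hb))) as [M [HM HMn]].
  apply (ex_series_le (K := R_AbsRing) (V := R_CompleteNormedModule) _ (fun n => M * (r / s) ^ n)).
  - intros n; change (Rabs (r ^ n * qabs (a n)) <= M * (r / s) ^ n).
    rewrite Rabs_pos_eq.
    2:{ apply Rmult_le_pos; [apply pow_le; lra | apply qabs_ge_0]. }
    specialize (HMn n); rewrite qabs_mul, qabs_pow, qabs_real, Rabs_pos_eq in HMn by lra.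
    replace (r ^ n) with ((r / s) ^ n * s ^ n).
    2:{ rewrite <- Rpow_mult_distr; f_equal; field; lra. }
    assert (0 <= (r / s) ^ n) by (apply pow_le, Rdiv_le_0_compat; lra).
    nra.
  - apply (ex_series_scal (K := R_AbsRing) (V := R_NormedModule) M), ex_series_geom.
    rewrite Rabs_pos_eq.
    + apply (Rmult_lt_reg_r s); [lra|]; unfold Rdiv; rewrite Rmult_assoc, Rinv_l; lra.
    + apply Rdiv_le_0_compat; lra.
Qed.

Lemma abs_conv_qpow (a : nat -> quat) (q : quat) :
  abs_conv a -> in_ball q -> ex_series (fun n => qabs (qmul (qpow q n) (a n))).
Proof.
  intros Ha Hq; destruct (Ha (qabs q)) as [l Hl].
  - split; [apply qabs_ge_0 | exact Hq].
  - exists l; revert Hl; apply is_series_ext; intros n.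
    now rewrite qabs_mul, qabs_pow.
Qed.

(** Write [q^n a_k b_(n-k)] as [q^(n-k) (q^k a_k) b_(n-k)]: summing over [k] first makes the middle
    factor [A]. It stays between the other two, so the limit is the sum of [q^n A b_n]. *)
Lemma qsum_cauchy_product (a b : nat -> quat) (q A L : quat) :
  abs_conv a -> abs_conv b -> in_ball q ->
  qsum (fun n => qmul (qpow q n) (a n)) A ->
  qsum (fun n => qmul (qpow q n) (qmul A (b n))) L ->
  qsum (fun n => qmul (qpow q n) (sum_n (fun k => qmul (a k) (b (n - k)%nat)) n)) L.
Proof.
  intros Ha Hb Hq HA HL c.
  assert (Hbe : forall e, ex_series (fun n => qabs (qmul (qpow q n) (qmul e (b n))))).
  { intros e.
    destruct (ex_series_scal (K := R_AbsRing) (V := R_NormedModule) (qabs e) _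
      (abs_conv_qpow b q Hb Hq)) as [l Hl].
    exists l; revert Hl; apply is_series_ext; intros n.
    change (qabs e * qabs (qmul (qpow q n) (b n)) = qabs (qmul (qpow q n) (qmul e (b n)))).
    rewrite !qabs_mul; ring. }
  assert (Hprod : forall e, is_series (fun n => sum_n (fun k =>
      qdot e (qmul (qpow q k) (a k)) * qdot c (qmul (qpow q (n - k)) (qmul e (b (n - k)%nat)))) n)
    (qdot e A * Series (fun n => qdot c (qmul (qpow q n) (qmul e (b n)))))).
  { intros e.
    apply (is_series_conv (fun k => qdot e (qmul (qpow q k) (a k)))
      (fun k => qdot c (qmul (qpow q k) (qmul e (b k))))).
    - apply HA.
    - apply Series_correct, ex_series_Rabs, ex_series_qdot, Hbe.
    - apply ex_series_qdot, abs_conv_qpow; auto.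
    - apply ex_series_qdot, Hbe. }
  assert (HS : forall e, ex_series (fun n => qdot c (qmul (qpow q n) (qmul e (b n))))).
  { intros e; apply ex_series_Rabs, ex_series_qdot, Hbe. }
  set (e0 := (1, 0, 0, 0) : quat) in *; set (e1 := (0, 1, 0, 0) : quat) in *.
  set (e2 := (0, 0, 1, 0) : quat) in *; set (e3 := (0, 0, 0, 1) : quat) in *.
  (* Expanding the middle factor along the basis 1, i, j, k turns the noncommutative product into
     four real Cauchy products. *)
  assert (Hdec : forall F p r', qdot c (qmul p (qmul F r'))
    = qdot e0 F * qdot c (qmul p (qmul e0 r')) + qdot e1 F * qdot c (qmul p (qmul e1 r'))
      + qdot e2 F * qdot c (qmul p (qmul e2 r')) + qdot e3 F * qdot c (qmul p (qmul e3 r'))).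
  { unfold e0, e1, e2, e3; clear; qring. }
  assert (HLc : qdot c L
    = plus (plus (plus (qdot e0 A * Series (fun n => qdot c (qmul (qpow q n) (qmul e0 (b n)))))
      (qdot e1 A * Series (fun n => qdot c (qmul (qpow q n) (qmul e1 (b n))))))
      (qdot e2 A * Series (fun n => qdot c (qmul (qpow q n) (qmul e2 (b n))))))
      (qdot e3 A * Series (fun n => qdot c (qmul (qpow q n) (qmul e3 (b n)))))).
  { rewrite <- (is_series_unique _ _ (HL c)).
    apply is_series_unique.
    apply is_series_ext with (fun n =>
      plus (plus (plus (scal (qdot e0 A) (qdot c (qmul (qpow q n) (qmul e0 (b n)))))
      (scal (qdot e1 A) (qdot c (qmul (qpow q n) (qmul e1 (b n))))))
      (scal (qdot e2 A) (qdot c (qmul (qpow q n) (qmul e2 (b n))))))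
      (scal (qdot e3 A) (qdot c (qmul (qpow q n) (qmul e3 (b n)))))).
    { intros n; now rewrite (Hdec A). }
    repeat apply (is_series_plus (V := R_NormedModule));
      apply (is_series_scal (V := R_NormedModule)), Series_correct, HS. }
  rewrite HLc.
  assert (Hsum := is_series_plus _ _ _ _ (is_series_plus _ _ _ _
    (is_series_plus _ _ _ _ (Hprod e0) (Hprod e1)) (Hprod e2)) (Hprod e3)).
  revert Hsum; apply is_series_ext; intros n.
  rewrite <- !sum_n_plus, qdot_mul_l, qdot_sum_n.
  apply sum_n_ext_loc; intros k Hk.
  rewrite <- qdot_mul_l.
  transitivity (qdot c (qmul (qpow q (n - k)) (qmul (qmul (qpow q k) (a k)) (b (n - k)%nat)))).
  - now rewrite (Hdec (qmul (qpow q k) (a k))).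
  - f_equal; rewrite <- !qmul_assoc, <- qpow_add; do 3 f_equal; lia.
Qed.

(** * Regular operations *)

Lemma qPSeries_expansion (a : nat -> quat) :
  abs_conv a -> is_expansion (qPSeries a) a.
Proof.
  intros Ha q Hq.
  destruct (ex_series_qsum _ (abs_conv_qpow a q Ha Hq)) as [l Hl].
  unfold qPSeries; rewrite (qsum_qSeries _ _ Hl).
  now apply qsum_is_series.
Qed.

Lemma qPSeries_ext (a b : nat -> quat) (q : quat) :
  (forall n, a n = b n) -> qPSeries a q = qPSeries b q.
Proof.
  intros Hab; unfold qPSeries, qSeries.
  apply quat_eq; apply Series_ext; intros n; now rewrite Hab.
Qed.

Lemma reg_conj_expansion (f : quat -> quat) (a : nat -> quat) :
  is_expansion f a -> is_expansion (reg_conj f) (fun n => qconj (a n)).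
Proof.
  intros Ha q Hq.
  assert (Hc : abs_conv (fun n => qconj (a n))).
  { intros r Hr; destruct (expansion_abs_conv f a Ha r Hr) as [l Hl].
    exists l; revert Hl; apply is_series_ext; intros n; now rewrite qabs_conj. }
  unfold reg_conj; rewrite (qPSeries_ext _ (fun n => qconj (a n))).
  - now apply qPSeries_expansion.
  - intros n; now rewrite (coeffs_eq f a).
Qed.

Lemma reg_mul_coeffs (f g : quat -> quat) (a b : nat -> quat) (q : quat) :
  is_expansion f a -> is_expansion g b ->
  reg_mul f g q = qPSeries (fun n => sum_n (fun k => qmul (a k) (b (n - k)%nat)) n) q.
Proof.
  intros Ha Hb; apply qPSeries_ext; intros n; apply sum_n_ext; intros k.
  now rewrite (coeffs_eq f a), (coeffs_eq g b).
Qed.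

(** With [F = f q], [q^n F b_n = F (F^-1 q F)^n b_n], and the conjugated point is still in the ball,
    where [g] is the sum of its expansion. *)
Lemma qsum_reg_mul (f g : quat -> quat) (a b : nat -> quat) (q : quat) :
  is_expansion f a -> is_expansion g b -> in_ball q -> f q <> qreal 0 ->
  qsum (fun n => qmul (qpow q n) (sum_n (fun k => qmul (a k) (b (n - k)%nat)) n))
    (qmul (f q) (g (qmul (qinv (f q)) (qmul q (f q))))).
Proof.
  intros Ha Hb Hq Hfq; apply qsum_cauchy_product with (f q); auto.
  - now apply (expansion_abs_conv f).
  - now apply (expansion_abs_conv g).
  - now apply is_series_qsum, Ha.
  - apply qsum_ext with (fun n =>
      qmul (f q) (qmul (qpow (qmul (qinv (f q)) (qmul q (f q))) n) (b n))).
    + intros n; now rewrite <- qmul_assoc, qpow_conjugation, qmul_assoc.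
    + apply qsum_mul_l, is_series_qsum, Hb.
      unfold in_ball; now rewrite qabs_conjugation.
Qed.

Lemma reg_mul_eval (f g : quat -> quat) (a b : nat -> quat) (q : quat) :
  is_expansion f a -> is_expansion g b -> in_ball q -> f q <> qreal 0 ->
  reg_mul f g q = qmul (f q) (g (qmul (qinv (f q)) (qmul q (f q)))).
Proof.
  intros Ha Hb Hq Hfq; rewrite (reg_mul_coeffs f g a b) by auto.
  now apply qsum_qSeries, qsum_reg_mul.
Qed.

(** Adding the sum to its reversal pairs [k] with [n - k], and [h p q + h q p] is real. Both
    [p conj(q)] and [conj(p) q] are admissible choices of [h], which gives [f^s] the same real
    coefficients from either order of the factors. *)
Lemma sum_n_symmetric (h : quat -> quat -> quat) (a : nat -> quat) (n : nat) :
  (forall p q, plus (h p q) (h q p) = qreal (2 * qdot p q)) ->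
  sum_n (fun k => h (a k) (a (n - k)%nat)) n
  = qreal (sum_n (fun k => qdot (a k) (a (n - k)%nat)) n).
Proof.
  intros Hh; apply qdot_ext; intros c; rewrite qdot_sum_n, !sum_n_Reals.
  set (F := fun k => qdot c (h (a k) (a (n - k)%nat))).
  assert (E : sum_f_R0 F n + sum_f_R0 F n
    = 2 * qdot c (qreal (sum_f_R0 (fun k => qdot (a k) (a (n - k)%nat)) n))).
  { rewrite <- (sum_f_R0_skip F n) at 2; rewrite <- sum_plus.
    transitivity (sum_f_R0 (fun k => qdot (a k) (a (n - k)%nat) * (2 * qre c)) n).
    - apply sum_eq; intros k Hk; unfold F.
      replace (n - (n - k))%nat with k by lia.
      rewrite <- qdot_plus, Hh; generalize (qdot (a k) (a (n - k)%nat)); qring.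
    - rewrite <- scal_sum.
      generalize (sum_f_R0 (fun k => qdot (a k) (a (n - k)%nat)) n); qring. }
  lra.
Qed.

(* f * f^c and f^c * f have the same coefficients, which are real. *)
Lemma reg_symm_conj_mul (f : quat -> quat) (a : nat -> quat) (q : quat) :
  is_expansion f a -> reg_symm f q = reg_mul (reg_conj f) f q.
Proof.
  intros Ha; unfold reg_symm.
  assert (Hc := reg_conj_expansion f a Ha).
  rewrite (reg_mul_coeffs f (reg_conj f) a (fun n => qconj (a n))) by auto.
  rewrite (reg_mul_coeffs (reg_conj f) f (fun n => qconj (a n)) a) by auto.
  apply qPSeries_ext; intros n.
  rewrite (sum_n_symmetric (fun p q => qmul p (qconj q))) by qring.
  rewrite (sum_n_symmetric (fun p q => qmul (qconj p) q)) by qring.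
  reflexivity.
Qed.

(** [q] commutes with its powers and with reals, so both products sum the same series. *)
Lemma qsum_real_coeffs_comm (s : nat -> R) (q l : quat) :
  qsum (fun n => qmul (qpow q n) (qreal (s n))) l -> qmul q l = qmul l q.
Proof.
  intros Hl.
  apply (qsum_unique (fun n => qmul q (qmul (qpow q n) (qreal (s n))))).
  - now apply qsum_mul_l.
  - apply qsum_ext with (fun n => qmul (qmul (qpow q n) (qreal (s n))) q).
    + intros n; rewrite qmul_assoc, qmul_real_comm, <- !qmul_assoc.
      now rewrite qpow_comm.
    + now apply qsum_mul_r.
Qed.

Lemma reg_symm_comm (f : quat -> quat) (a : nat -> quat) (q : quat) :
  is_expansion f a -> in_ball q -> f q <> qreal 0 ->
  qmul q (reg_symm f q) = qmul (reg_symm f q) q.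
Proof.
  intros Ha Hq Hfq; assert (Hc := reg_conj_expansion f a Ha).
  apply (qsum_real_coeffs_comm (fun n => sum_n (fun k => qdot (a k) (a (n - k)%nat)) n)).
  unfold reg_symm; rewrite (reg_mul_eval f _ a _ q Ha Hc) by auto.
  generalize (qsum_reg_mul f _ a _ q Ha Hc Hq Hfq); apply qsum_ext; intros n.
  now rewrite (sum_n_symmetric (fun p q => qmul p (qconj q))) by qring.
Qed.

(* B and C are the sums of Re (z^n) a_n and Im (z^n) a_n, where z = x + i y; they
   do not depend on I. *)
Lemma slice_representation (a : nat -> quat) (x y : R) :
  abs_conv a -> Cmod (x, y) < 1 ->
  exists B C : quat,
    (forall I, imag_unit I ->
      qsum (fun n => qmul (qpow (slice_pt I x y) n) (a n)) (plus B (qmul I C))) /\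
    (forall I, imag_unit I ->
      qsum (fun n => qmul (qpow (slice_pt I x y) n) (qconj (a n)))
        (plus (qconj B) (qmul I (qconj C)))).
Proof.
  intros Ha Hxy.
  assert (Hbound : forall s : nat -> R, (forall n, Rabs (s n) <= Cmod (x, y) ^ n) ->
    exists l, qsum (fun n => qmul (qreal (s n)) (a n)) l).
  { intros s Hs; apply ex_series_qsum.
    apply (ex_series_le (K := R_AbsRing) (V := R_CompleteNormedModule) _
      (fun n => Cmod (x, y) ^ n * qabs (a n))).
    - intros n; change (Rabs (qabs (qmul (qreal (s n)) (a n))) <= Cmod (x, y) ^ n * qabs (a n)).
      rewrite Rabs_pos_eq by apply qabs_ge_0; rewrite qabs_mul, qabs_real.
      apply Rmult_le_compat_r; [apply qabs_ge_0 | apply Hs].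
    - apply Ha; split; [apply Cmod_ge_0 | auto]. }
  destruct (Hbound (fun n => fst ((x, y) ^ n)%C)) as [B HB].
  { intros n; rewrite <- Cmod_pow; eapply Rle_trans; [apply Rmax_l | apply Rmax_Cmod]. }
  destruct (Hbound (fun n => snd ((x, y) ^ n)%C)) as [C HC].
  { intros n; rewrite <- Cmod_pow; eapply Rle_trans; [apply Rmax_r | apply Rmax_Cmod]. }
  exists B, C; split; intros I HI.
  - apply qsum_ext with (fun n => plus (qmul (qreal (fst ((x, y) ^ n)%C)) (a n))
      (qmul I (qmul (qreal (snd ((x, y) ^ n)%C)) (a n)))).
    + intros n; rewrite qpow_slice_pt by auto.
      generalize (fst ((x, y) ^ n)%C) (snd ((x, y) ^ n)%C) (a n); clear; qring.
    + apply qsum_plus; auto; now apply qsum_mul_l.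
  - apply qsum_ext with (fun n => plus (qconj (qmul (qreal (fst ((x, y) ^ n)%C)) (a n)))
      (qmul I (qconj (qmul (qreal (snd ((x, y) ^ n)%C)) (a n))))).
    + intros n; rewrite qpow_slice_pt by auto.
      generalize (fst ((x, y) ^ n)%C) (snd ((x, y) ^ n)%C) (a n); clear; qring.
    + apply qsum_plus; [|apply qsum_mul_l]; now apply qsum_conj.
Qed.

(** On the sphere [x + y S], [f] is [B + J C] and [f^c] is [conj(B) + J conj(C)]. A zero of [f^c] at
    [J = I] forces [B = C I], and then [B + J C = 0] can be solved for a unit [J] by conjugating [I]
    with [C]. *)
Lemma reg_conj_neq_0 (f : quat -> quat) (a : nat -> quat) :
  is_expansion f a -> (forall q, in_ball q -> f q <> qreal 0) ->
  forall q, in_ball q -> reg_conj f q <> qreal 0.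
Proof.
  intros Ha Hf q Hq E.
  assert (Hc := is_series_qsum _ _ (reg_conj_expansion f a Ha q Hq)).
  destruct (slice_pt_surjective q) as [I [x [y [HI ->]]]].
  assert (Hxy : Cmod (x, y) < 1) by (now rewrite <- (qabs_slice_pt I)).
  destruct (slice_representation a x y (expansion_abs_conv f a Ha) Hxy) as [B [C [HB HC]]].
  assert (HfJ : forall J, imag_unit J -> f (slice_pt J x y) = plus B (qmul J C)).
  { intros J HJ; apply (qsum_unique (fun n => qmul (qpow (slice_pt J x y) n) (a n))); auto.
    apply is_series_qsum, Ha; unfold in_ball; now rewrite qabs_slice_pt. }
  rewrite (qsum_unique _ _ _ Hc (HC I HI)) in E.
  destruct (imag_unit_coord I HI) as [b1 [c1 [d1 [EI _]]]].
  assert (EB : B = qmul C I).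
  { apply (f_equal qconj) in E.
    transitivity (plus (qconj (plus (qconj B) (qmul I (qconj C)))) (qmul C I)).
    - rewrite EI; clear; qring.
    - rewrite E; clear; qring. }
  (* If [C = 0] then [B = 0] as well, and [f] already vanishes at the given point. *)
  destruct (Req_dec (qabs C) 0) as [H0 | H0].
  - apply qabs_eq_0 in H0; apply (Hf _ Hq).
    rewrite HfJ, EB, H0 by auto; clear; qring.
  - assert (HC0 : C <> qreal 0).
    { intros ->; apply H0; now rewrite qabs_real, Rabs_R0. }
    (* B + J C = 0 for this J, as B = C I. *)
    set (J := qmul (qreal (-1)) (qmul C (qmul I (qinv C)))).
    assert (HJ : imag_unit J).
    { assert (HP : forall P, qmul (qmul (qreal (-1)) P) (qmul (qreal (-1)) P) = qmul P P)
        by (clear; qring).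
      unfold imag_unit, J; rewrite HP, !qmul_assoc.
      rewrite <- (qmul_assoc (qinv C)), qinv_l, qmul_1_l by auto.
      rewrite <- (qmul_assoc I I), HI, qmul_real_comm, <- qmul_assoc, qinv_r, qmul_1_l by auto.
      reflexivity. }
    apply (Hf (slice_pt J x y)).
    + unfold in_ball; now rewrite qabs_slice_pt.
    + rewrite HfJ, EB by auto; unfold J.
      rewrite !qmul_assoc, qinv_l, qmul_1_r by auto.
      generalize (qmul C I); clear; qring.
Qed.

Theorem proposition3p6 (f g : quat -> quat)
  (hf : slice_regular f) (hg : slice_regular g)
  (hf0 : forall q : quat, in_ball q -> f q <> qreal 0) :
  ((forall q : quat, in_ball q -> 0 < qre (qmul (qinv (f q)) (g q))) <->
   (forall q : quat, in_ball q -> 0 < qre (reg_recip_mul f g q))) /\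
  ((forall q : quat, in_ball q -> qabs (g q) < qabs (f q)) <->
   (forall q : quat, in_ball q -> qabs (reg_recip_mul f g q) < 1)).
Proof.
  assert (Ha := coeffs_expansion f hf); assert (Hb := coeffs_expansion g hg).
  set (a := coeffs f) in Ha; set (b := coeffs g) in Hb.
  assert (Hc := reg_conj_expansion f a Ha).
  assert (Hc0 := reg_conj_neq_0 f a Ha hf0).
  set (T := fun q => qmul (qinv (reg_conj f q)) (qmul q (reg_conj f q))).
  assert (HTball : forall q, in_ball q -> in_ball (T q)).
  { intros q Hq; unfold in_ball, T; rewrite qabs_conjugation; auto. }
  (* Both [f^s = f^c * f] and [f^c * g] are evaluated at [T q] with the same left factor [f^c(q)],
     which cancels. *)
  assert (HTeval : forall q, in_ball q ->
    reg_recip_mul f g q = qmul (qinv (f (T q))) (g (T q))).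
  { intros q Hq; unfold reg_recip_mul.
    rewrite (reg_symm_conj_mul f a q Ha).
    rewrite (reg_mul_eval _ f _ a q Hc Ha), (reg_mul_eval _ g _ b q Hc Hb) by auto.
    fold (T q).
    rewrite qinv_mul, qmul_assoc, <- (qmul_assoc (qinv (reg_conj f q))), qinv_l, qmul_1_l; auto. }
  (* With [F = f p], [q = F^-1 p F] and [G = f^c(q)], one gets [T q = (F G)^-1 p (F G)]; here [F G]
     is [f^s(p)], which commutes with [p]. *)
  assert (HTsurj : forall p, in_ball p -> exists q, in_ball q /\ T q = p).
  { intros p Hp; exists (qmul (qinv (f p)) (qmul p (f p))).
    assert (Hq : in_ball (qmul (qinv (f p)) (qmul p (f p)))).
    { unfold in_ball; rewrite qabs_conjugation; auto. }
    split; auto; unfold T.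
    assert (HG := Hc0 _ Hq); revert HG.
    assert (HS : reg_symm f p = qmul (f p) (reg_conj f (qmul (qinv (f p)) (qmul p (f p))))).
    { now apply (reg_mul_eval f (reg_conj f) a _ p Ha Hc Hp), hf0. }
    assert (Hcomm : qmul p (reg_symm f p) = qmul (reg_symm f p) p).
    { apply (reg_symm_comm f a); auto. }
    rewrite HS in Hcomm; clear HS; revert Hcomm.
    generalize (reg_conj f (qmul (qinv (f p)) (qmul p (f p)))) (hf0 p Hp).
    generalize (f p); intros F G HF Hcomm HG.
    rewrite !qmul_assoc, <- (qmul_assoc (qinv G)), <- qinv_mul, Hcomm by auto.
    rewrite <- qmul_assoc, qinv_l, qmul_1_l by now apply qmul_neq_0.
    reflexivity. }
  assert (Hquot : forall p, in_ball p ->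
    (qabs (qmul (qinv (f p)) (g p)) < 1 <-> qabs (g p) < qabs (f p))).
  { intros p Hp; assert (Hfp := hf0 p Hp).
    rewrite qabs_mul, qabs_inv by auto; apply qabs_gt_0 in Hfp.
    rewrite Rmult_comm; split; intros H.
    - apply (Rmult_lt_compat_r (qabs (f p))) in H; auto.
      rewrite Rmult_assoc, Rinv_l in H; lra.
    - apply (Rmult_lt_reg_r (qabs (f p))); auto.
      rewrite Rmult_assoc, Rinv_l; lra. }
  (* The forward directions use that [T] stays in the ball, the backward ones that it is onto. *)
  split; split; intros H q Hq.
  - rewrite HTeval; auto.
  - destruct (HTsurj q Hq) as [p [Hp <-]]; rewrite <- HTeval; auto.
  - rewrite HTeval by auto; apply Hquot; auto.
  - destruct (HTsurj q Hq) as [p [Hp <-]]; apply Hquot; auto.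
    rewrite <- HTeval; auto.
Qed.
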